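(* Let $\Phi$ be a point-stationary point process in $\mathbb R^k$ endowed with the $l_\infty$ metric, and let $\alpha\ge0$. Then there exists an equivariant weight function $\boldsymbol w$ on $\Phi$ such that, almost surely, $$\forall v\in\Phi,\ \forall r\ge1:\quad\boldsymbol w(N_r(v))\le r^\alpha,$$ and $$\mathbb E[\boldsymbol w(0)]\ge3^{-k}\,\mathcal H^\alpha_1(\Phi).$$ In particular, if $\mathcal H^\alpha_1(\Phi)>0$, then $\boldsymbol w(0)$ is not identically zero.
   Context: Point processes. A point process in $\mathbb R^k$ is a random locally finite subset $\Phi\subseteq\mathbb R^k$. It is point-stationary if $0\in\Phi$ a.s. and $\mathbb E[\sum_{x\in\Phi}g(\Phi,0,x)]=\mathbb E[\sum_{x\in\Phi}g(\Phi,x,0)]$ for all measurable $g(\varphi,x,y)\ge0$ ($\varphi\subseteq\mathbb R^k$ discrete, $x,y\in\varphi$) invariant under joint translations. Equivariant processes. An equivariant process with values in a complete separable metric space $\Xi$ on $\Phi$ assigns to (almost) every realization $\varphi$ a random marking $\boldsymbol Z_\varphi\in\Xi^{\varphi\times\varphi}$ (extra randomness allowed; the mark of a point $x$ is that of $(x,x)$), depending measurably on $\varphi$, such that for every translation $\rho$, $\boldsymbol Z_\varphi\circ\rho^{-1}$ has the same distribution as $\boldsymbol Z_{\rho(\varphi)}$. An equivariant weight function is an equivariant process with values in $[0,\infty)$ (marks on points); $\boldsymbol w(A):=\sum_{v\in\Phi\cap A}\boldsymbol w(v)$. Hausdorff content. $N_r(v)$ is the closed ball in $\Phi$ of radius $r\ge1$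 centered at $v$ and $N_0(v):=\emptyset$. An equivariant covering is an equivariant process $\boldsymbol R$ with values in $\{0\}\cup[1,\infty)$ on points such that the balls $N_{\boldsymbol R(v)}(v)$, $v\in\Phi$, cover $\Phi$ a.s. $\mathcal H^\alpha_1(\Phi):=\inf_{\boldsymbol R}\mathbb E[\boldsymbol R(0)^\alpha]$ over all equivariant coverings, with $0^0:=0$. *)

(* Defs.v *)
From HB Require Import structures.
From mathcomp Require Import all_boot all_order all_algebra.
From mathcomp Require Import all_classical all_reals all_analysis.

Set Implicit Arguments.
Unset Strict Implicit.
Unset Printing Implicit Defensive.

Import Order.TTheory GRing.Theory Num.Theory.
Import numFieldNormedType.Exports.

Local Open Scope classical_set_scope.
Local Open Scope ring_scope.

(* The norm of ['rV[R]_k] is the maximum of the absolute values of the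
   coordinates, so [`|x - y|] is the l_infinity distance. *)
Definition borel_rV (R : realType) (k : nat) :=
  g_sigma_algebraType (@open 'rV[R]_k).

Definition locally_finite (R : realType) (k : nat) (A : set 'rV[R]_k) : Prop :=
  forall B : set 'rV[R]_k, bounded_set B -> finite_set (A `&` B).

Lemma locally_finite0 (R : realType) (k : nat) :
  locally_finite (@set0 'rV[R]_k).
Proof. by move=> B _; rewrite set0I. Qed.

Lemma locally_finite_shift (R : realType) (k : nat) (t : 'rV[R]_k)
    (A : set 'rV[R]_k) :
  locally_finite A -> locally_finite [set x | A (x - t)].
Proof.
move=> lfA B bB.
have bBt : bounded_set [set y | B (y + t)].
  move: bB => [M [Mreal MB]]; exists (M + `|t|); split.
    by rewrite realD// normr_real.
  move=> r ltMr y /= By; rewrite -[y](addrK t) (le_trans (ler_normB _ _))//.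
  by rewrite -lerBrDr; apply: MB By; rewrite ltrBrDr.
apply: (@sub_finite_set _ _ ((fun y => y + t) @` (A `&` [set y | B (y + t)]))).
  move=> x [/= Ax Bx]; exists (x - t); last by rewrite subrK.
  by split => //=; rewrite subrK.
exact: finite_image (lfA _ bBt).
Qed.

Record config (R : realType) (k : nat) := Config {
  pts : set 'rV[R]_k ;
  pts_locally_finite : locally_finite pts }.

HB.instance Definition _ (R : realType) (k : nat) :=
  gen_eqMixin (config R k).
HB.instance Definition _ (R : realType) (k : nat) :=
  gen_choiceMixin (config R k).
HB.instance Definition _ (R : realType) (k : nat) :=
  isPointed.Build (config R k) (Config (@locally_finite0 R k)).

Definition config_shift (R : realType) (k : nat) (t : 'rV[R]_k)
    (phi : config R k) : config R k :=
  Config (locally_finite_shift t (@pts_locally_finite R k phi)).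

(* The sigma-algebra on configurations generated by the counts
   [phi |-> #(phi `&` B)], B bounded Borel. *)
Definition config_count (R : realType) (k : nat) : set (set (config R k)) :=
  [set E | exists (B : set (borel_rV R k)) (n : nat),
     [/\ measurable B, bounded_set (B : set 'rV[R]_k) &
       E = [set phi | (pts phi `&` B #= `I_n)%card]]].

Definition configT (R : realType) (k : nat) :=
  g_sigma_algebraType (@config_count R k).

(* A configuration phi together with an element of R^(phi x phi); the marking
   is stored as a function on all pairs that vanishes outside phi x phi. *)
Record marked_config (R : realType) (k : nat) := MarkedConfig {
  ground : config R k ;
  mark : 'rV[R]_k -> 'rV[R]_k -> R ;
  mark_out : forall x y, ~ (pts ground x /\ pts ground y) -> mark x y = 0 }.

HB.instance Definition _ (R : realType) (k : nat) :=
  gen_eqMixin (marked_config R k).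
HB.instance Definition _ (R : realType) (k : nat) :=
  gen_choiceMixin (marked_config R k).
HB.instance Definition _ (R : realType) (k : nat) :=
  isPointed.Build (marked_config R k)
    (@MarkedConfig R k point (fun _ _ => 0) (fun _ _ _ => erefl)).

Lemma mark_out_shift (R : realType) (k : nat) (t : 'rV[R]_k)
    (z : marked_config R k) (x y : 'rV[R]_k) :
  ~ (pts (config_shift t (ground z)) x /\ pts (config_shift t (ground z)) y) ->
  mark z (x - t) (y - t) = 0.
Proof. exact: mark_out. Qed.

Definition marked_shift (R : realType) (k : nat) (t : 'rV[R]_k)
    (z : marked_config R k) : marked_config R k :=
  MarkedConfig (@mark_out_shift R k t z).

(* The sigma-algebra of the marked point process of the triples
   (x, y, mark of (x, y)). *)
Definition marked_count (R : realType) (k : nat) :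
    set (set (marked_config R k)) :=
  [set E | exists (B1 B2 : set (borel_rV R k)) (C : set R) (n : nat),
     [/\ measurable B1 /\ bounded_set (B1 : set 'rV[R]_k),
         measurable B2 /\ bounded_set (B2 : set 'rV[R]_k),
         measurable C &
       E = [set z | ([set u : 'rV[R]_k * 'rV[R]_k |
                      [/\ pts (ground z) u.1 /\ B1 u.1,
                          pts (ground z) u.2 /\ B2 u.2 &
                          C (mark z u.1 u.2)]] #= `I_n)%card]]].

Definition markedT (R : realType) (k : nat) :=
  g_sigma_algebraType (@marked_count R k).

(* The mark of the point x is that of the pair (x, x). *)
Definition pmark (R : realType) (k : nat) (z : marked_config R k)
    (x : 'rV[R]_k) : R := mark z x x.

(* The test functions [g] are total; their values at points outside the
   configuration play no role since 0 is in [Phi] almost surely. *)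
Definition point_stationary (R : realType) (k : nat) (d : measure_display)
    (Omega : measurableType d) (P : probability Omega R)
    (Phi : Omega -> configT R k) : Prop :=
  {ae P, forall o, pts (Phi o) 0} /\
  forall g : config R k -> 'rV[R]_k -> 'rV[R]_k -> R,
    measurable_fun [set: configT R k * borel_rV R k * borel_rV R k]
      (fun u => g u.1.1 u.1.2 u.2) ->
    (forall phi x y, 0 <= g phi x y) ->
    (forall t phi x y, g (config_shift t phi) (x + t) (y + t) = g phi x y) ->
    (\int[P]_o (\esum_(x in pts (Phi o)) (g (Phi o) 0 x)%:E) =
     \int[P]_o (\esum_(x in pts (Phi o)) (g (Phi o) x 0)%:E))%E.

(* An equivariant process on [Phi] with values in [Xi] is given by the
   probability kernel sending phi to the distribution of phi marked by Z_phi.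
   It is prescribed on a translation-invariant event [D] of full probability
   and unconstrained elsewhere. *)
Definition equivariant_process (R : realType) (k : nat) (d : measure_display)
    (Omega : measurableType d) (P : probability Omega R)
    (Phi : Omega -> configT R k) (Xi : set R)
    (Z : R.-pker configT R k ~> markedT R k) : Prop :=
  exists D : set (configT R k),
    [/\ measurable D,
        {ae P, forall o, D (Phi o)},
        (forall t phi, D phi -> D (config_shift t phi)),
        (forall phi, D phi -> {ae Z phi, forall z, ground z = phi /\
           forall x y, pts phi x -> pts phi y -> Xi (mark z x y)}) &
        (forall t phi (A : set (markedT R k)), D phi -> measurable A ->
           Z (config_shift t phi) A = Z phi (marked_shift t @^-1` A))].

(* "Almost surely", for the pair formed by [Phi] and the marking. *)
Definition almost_surely (R : realType) (k : nat) (d : measure_display)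
    (Omega : measurableType d) (P : probability Omega R)
    (Phi : Omega -> configT R k) (Z : R.-pker configT R k ~> markedT R k)
    (Q : config R k -> marked_config R k -> Prop) : Prop :=
  {ae P, forall o, {ae Z (Phi o), forall z, Q (Phi o) z}}.

Definition expectation_marked (R : realType) (k : nat) (d : measure_display)
    (Omega : measurableType d) (P : probability Omega R)
    (Phi : Omega -> configT R k) (Z : R.-pker configT R k ~> markedT R k)
    (f : marked_config R k -> R) : \bar R :=
  (\int[P]_o (\int[Z (Phi o)]_z (f z)%:E))%E.

Definition equivariant_weight (R : realType) (k : nat) (d : measure_display)
    (Omega : measurableType d) (P : probability Omega R)
    (Phi : Omega -> configT R k)
    (w : R.-pker configT R k ~> markedT R k) : Prop :=
  equivariant_process P Phi [set s : R | 0 <= s] w.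

Definition weight_of (R : realType) (k : nat) (z : marked_config R k)
    (A : set 'rV[R]_k) : \bar R :=
  (\esum_(v in pts (ground z) `&` A) (pmark z v)%:E)%E.

(* N_r(v), used for r = 0 and r >= 1 only; N_0(v) is empty. *)
Definition nball (R : realType) (k : nat) (phi : config R k) (r : R)
    (v : 'rV[R]_k) : set 'rV[R]_k :=
  [set u | [/\ r != 0, pts phi u & `|u - v| <= r]].

Definition equivariant_covering (R : realType) (k : nat) (d : measure_display)
    (Omega : measurableType d) (P : probability Omega R)
    (Phi : Omega -> configT R k)
    (Z : R.-pker configT R k ~> markedT R k) : Prop :=
  equivariant_process P Phi [set s : R | s = 0 \/ 1 <= s] Z /\
  almost_surely P Phi Z (fun phi z =>
    forall u, pts phi u -> exists2 v, pts phi v & nball phi (pmark z v) v u).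

(* r^alpha with the convention 0^0 = 0 (whereas [0 `^ 0 = 1]). *)
Definition rpow (R : realType) (r alpha : R) : R :=
  if r == 0 then 0 else r `^ alpha.

Definition hausdorff1 (R : realType) (k : nat) (d : measure_display)
    (Omega : measurableType d) (P : probability Omega R)
    (Phi : Omega -> configT R k) (alpha : R) : \bar R :=
  ereal_inf [set e | exists2 Z : R.-pker configT R k ~> markedT R k,
    equivariant_covering P Phi Z &
    e = expectation_marked P Phi Z (fun z => rpow (pmark z 0) alpha)].

(* Main.v *)
Require Import Defs.
From HB Require Import structures.
From mathcomp Require Import all_boot all_order all_algebra finmap.
From mathcomp Require Import all_classical all_reals all_analysis measurable_realfun.
From mathcomp Require Import ring lra zify.

Set Implicit Arguments.
Unset Strict Implicit.
Unset Printing Implicit Defensive.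

Import Order.TTheory GRing.Theory Num.Theory.
Import numFieldNormedType.Exports.

Local Open Scope classical_set_scope.
Local Open Scope ring_scope.

(* Fix the grid of dyadic cubes of sides 1, 2, 4, ..., 2^M shifted by a uniform
   u, and run Frostman's procedure on it: give mass 1 to each nonempty unit cell
   and, level by level, rescale the weights in every cell of side l whose mass
   exceeds l^alpha so that it becomes l^alpha. At the end the maximal cells of
   mass l^alpha (the saturated ones) partition the points. Placing a ball of
   radius l at the lexicographically first point of each of them gives an
   equivariant covering R (u is the extra randomness), and transporting the mass
   of each point to that first point of its cell gives E[R(0)^alpha] = E[w_M(0)],
   where w_M is the average over u of the final weights. As M grows w_M
   decreases, to a limit w with E[w(0)] >= H.

   For the upper bound, let 2^n <= r <= 2^(n+1) and s = 2^(n+1) / r. A cell of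
   side 2^(n+1) met by N_r(v) contributes at most 2^((n+1) alpha), and at most
   2^m 2^(n alpha) if the ball meets both of its halves in m coordinates only;
   both cases are covered by r^alpha s^m. The sum of s^m over the cells is a
   product over the coordinates, and in one coordinate the average over u is
   (2 - s) (1 + 2/s) + (s - 1) (1 + 4/s) = 3. Hence w(N_r(v)) <= 3^k r^alpha, and
   3^-k w is the required weight. *)

(** * Sums over configurations *)

(** The law of [u] is uniform on a box and not invariant under translations, but the weights of the
    levels up to [M] depend on [u] only modulo [2 ^+ M]. On such periodic functions the uniform
    average is translation invariant, and it is the same over every box of side [2 ^+ M'] with
    [M' >= M]. The first fact gives equivariance; the second makes the averages w_M comparable
    although [u] has a different law for each [M]. The levels are cut off at [M] because with
    infinitely many levels a point may have no maximal saturated cell, hence no ball to cover it.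
    The inequality E[w_M(0)] >= H passes to the limit since all weights are at most 1; the ball
    bound does since a ball of fixed radius involves only two levels. For a single [u] the ball
    estimate can exceed 3^k r^alpha; averaging brings the constant down to 3^k. It also makes w a
    function of the configuration alone, and turns the transported mass into a function of the
    configuration and two points, the kind of test function that point-stationarity covers. *)

Lemma esum_series (R : realType) (T : pointedType) (S : set T) :
  countable S -> exists (e : nat -> T) (p : pred nat),
    (forall j, p j -> S (e j)) /\
    forall a : T -> \bar R, (forall x, S x -> (0 <= a x)%E) ->
      (\esum_(x in S) a x = \sum_(j <oo | p j) a (e j))%E.
Proof.
move=> /countable_bijP[B]; rewrite card_eq_sym => /card_set_bijP[e ebij].
exists e, (fun j => j \in B); split=> [j|a a0].
  by rewrite inE => Bj; case: ebij => eB _ _; exact: eB.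
rewrite (reindex_esum _ _ _ _ ebij) nneseries_esum; last first.
  by move=> n; rewrite inE => Bn; apply: a0; case: ebij => eB _ _; exact: eB.
by congr esum; apply/seteqP; split=> x /=; rewrite inE.
Qed.

Section counting_measure_on.
Context d (V : measurableType d) (R : realType) (S : set V).

(** Sums over a configuration become integrals against this measure, so that kernel arguments apply
    to their dependence on parameters. *)
Definition cntm (B : set V) : \bar R := (\esum_(y in S) (\1_B y)%:E)%E.

Let cntm0 : cntm set0 = 0%E.
Proof. by rewrite /cntm esum1// => i _; rewrite indic0. Qed.

Let cntm_ge0 B : (0 <= cntm B)%E.
Proof. by apply: esum_ge0 => x _; rewrite lee_fin. Qed.

Lemma cntmE B : cntm B = (\esum_(y in S `&` B) 1)%E.
Proof.
rewrite /cntm esum_mkcondr; apply: eq_esum => i _.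
by rewrite indicE; case: ifP.
Qed.

Let cntm_sigma_additive : semi_sigma_additive cntm.
Proof.
move=> F mF tF mUF; rewrite cntmE.
rewrite setI_bigcupr nneseries_sum_bigcup//; last first.
  by apply: trivIset_setIl.
under eq_eseriesr do rewrite -cntmE.
by apply: is_cvg_nneseries => n _ _.
Qed.

HB.instance Definition _ := isMeasure.Build d V R cntm
  cntm0 cntm_ge0 cntm_sigma_additive.

Lemma integral_cntm (f : V -> \bar R) : countable S ->
  measurable_fun setT f -> (forall x, (0 <= f x)%E) ->
  (\int[cntm]_x f x = \esum_(x in S) f x)%E.
Proof.
move=> cS mf f0; have [e [p [pS eE]]] := @esum_series R _ S cS.
pose m_ j : {measure set V -> \bar R} :=
  if p j then (dirac (e j) : {measure set V -> \bar R}) else mzero.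
have m_E j (g : V -> \bar R) : measurable_fun setT g -> (forall x, (0 <= g x)%E) ->
    (\int[m_ j]_x g x = if p j then g (e j) else 0)%E.
  move=> mg g0; rewrite /m_; case: (p j).
    by rewrite integral_dirac// diracT mul1e.
  by rewrite integral_measure_zero.
rewrite (@eq_measure_integral _ _ _ _ (mseries m_ 0)).
  rewrite ge0_integral_measure_series//.
  apply: etrans (esym (eE f _)); last by [].
  rewrite [RHS]eseries_mkcond.
  by apply: eq_eseriesr => j _; exact: m_E.
move=> A mA _; apply: (etrans (eE (fun y => (\1_A y)%:E) _)).
  by move=> x _; rewrite lee_fin.
rewrite eseries_mkcond /mseries; apply: eq_eseriesr => j _.
by rewrite /m_; case: (p j).
Qed.

End counting_measure_on.

Lemma esum_card (R : realType) (T : choiceType) (A : set T) (n : nat) :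
  (A #= `I_n)%card -> (\esum_(x in A) 1 = n%:R%:E :> \bar R)%E.
Proof.
move=> An; have fA : finite_set A by apply/finite_setP; exists n.
rewrite esum_fset// fsbig_finite//= -(card_fset_set An).
by rewrite sumEFin big_const_seq count_predT iter_addr_0.
Qed.

Lemma esum_card_eq (R : realType) (T : choiceType) (A : set T) (n : nat) :
  finite_set A -> (\esum_(x in A) 1 = n%:R%:E :> \bar R)%E -> (A #= `I_n)%card.
Proof.
move=> /finite_setP[m Am]; rewrite (esum_card _ Am) => -[] /eqP.
by rewrite eqr_nat => /eqP <-.
Qed.

Lemma measurable_pred d (X : measurableType d) (b : X -> bool) :
  measurable_fun setT b -> measurable [set x | b x].
Proof.
move=> mb; rewrite (_ : [set x | b x] = setT `&` b @^-1` [set true]).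
  exact: mb.
by rewrite setTI; apply/seteqP; split=> x /=.
Qed.

Lemma pred_measurable d (X : measurableType d) (b : X -> bool) :
  measurable [set x | b x] -> measurable_fun setT b.
Proof. by move=> mb; apply: (@measurable_fun_bool _ _ _ _ true); rewrite setTI. Qed.

Section configurations.
Context (R : realType) (k : nat).
Notation V := (borel_rV R k).

Definition centered_ball (n : nat) : set V :=
  [set y | `|(y : 'rV[R]_k)| <= n%:R].

Lemma bounded_set_le (A : set 'rV[R]_k) (M : R) :
  (forall x, A x -> `|x| <= M) -> bounded_set A.
Proof.
move=> AM; exists M; split; first exact: num_real.
by move=> r Mr x Ax /=; exact: le_trans (AM x Ax) (ltW Mr).
Qed.

Lemma sub_bounded_set (A B : set 'rV[R]_k) :
  A `<=` B -> bounded_set B -> bounded_set A.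
Proof.
move=> AB [M [Mreal MB]]; exists M; split=> // r Mr x Ax /=.
exact: MB Mr x (AB x Ax).
Qed.

Lemma bounded_centered_ball n : bounded_set (centered_ball n : set 'rV[R]_k).
Proof. by apply: (@bounded_set_le _ n%:R). Qed.

Lemma measurable_coord (i : 'I_k) :
  measurable_fun [set: V] (fun y : V => (y : 'rV[R]_k) ord0 i).
Proof.
apply: (measurability _ (RGenOInfty.measurableE R)) => _ [_ [a ->] <-].
rewrite setTI; apply: sub_sigma_algebra => /=.
apply: (@open_comp _ _ (fun y : 'rV[R]_k => y ord0 i) `]a, +oo[%classic).
  by move=> ? _; exact: coord_continuous.
exact: interval_open.
Qed.

Lemma rV_norm_le (y : 'rV[R]_k) (a : R) : 0 <= a ->
  (`|y| <= a) <-> (forall i, `|y ord0 i| <= a).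
Proof.
move=> a0; split=> [ya i|ya].
  apply: le_trans ya; rewrite /Num.norm/= mx_normrE.
  exact: (le_bigmax _ _ (ord0, i)).
rewrite /Num.norm/= mx_normrE; apply/bigmax_leP; split=> //= -[i j] _ /=.
by rewrite (ord1 i).
Qed.

Lemma measurable_centered_ball n : measurable (centered_ball n).
Proof.
rewrite (_ : centered_ball n = \bigcap_(i in [set: 'I_k])
   [set y : V | `|(y : 'rV[R]_k) ord0 i| <= n%:R]); last first.
  apply/seteqP; split=> y /=.
    by move=> /rV_norm_le h i _; apply: h; rewrite ?ler0n.
  by move=> h; apply/rV_norm_le => [|i]; [rewrite ler0n|exact: h].
apply: fin_bigcap_measurable => // i _.
apply: measurable_pred; apply: measurable_fun_ler => //.
exact: measurableT_comp (@normr_measurable R setT) (measurable_coord i).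
Qed.

Lemma measurable_rV1 (v : 'rV[R]_k) : measurable ([set v] : set V).
Proof.
rewrite (_ : [set v] = \bigcap_(i in [set: 'I_k])
   [set y : V | (y : 'rV[R]_k) ord0 i == v ord0 i]); last first.
  apply/seteqP; split=> y /= => [-> i _ /=|h]; first exact: eqxx.
  by apply/rowP => i; apply/eqP/(h i).
apply: fin_bigcap_measurable => // i _.
apply: measurable_pred; apply: measurable_fun_eqr => //.
exact: measurable_coord.
Qed.

Lemma bounded_rV1 (v : 'rV[R]_k) : bounded_set [set v].
Proof. by apply: (@bounded_set_le _ `|v|) => y ->. Qed.

Lemma bigcup_centered_ball : \bigcup_n centered_ball n = setT.
Proof.
apply/seteqP; split=> // y _; exists (Num.truncn `|y|).+1 => //=.
by apply/ltW; rewrite truncnS_gt.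
Qed.

Lemma centered_ball_nd : {homo centered_ball : m n / (m <= n)%N >-> m `<=` n}.
Proof. by move=> m n mn y /= /le_trans; apply; rewrite ler_nat. Qed.

Lemma locally_finite_countable (A : set 'rV[R]_k) :
  locally_finite A -> countable A.
Proof.
move=> lfA; rewrite -[A]setIT -bigcup_centered_ball setI_bigcupr.
apply: bigcup_countable => // n _; apply: finite_set_countable.
exact: lfA (bounded_centered_ball n).
Qed.

Lemma pts_countable (phi : config R k) : countable (pts phi).
Proof. exact/locally_finite_countable/pts_locally_finite. Qed.

Lemma finite_ball (phi : config R k) (v : 'rV[R]_k) (r : R) :
  finite_set (pts phi `&` [set x | `|x - v| <= r]).
Proof.
apply: (pts_locally_finite phi); apply: (@bounded_set_le _ (`|v| + r)).
by move=> x /= xv; rewrite -[x](subrK v) addrC (le_trans (ler_normD _ _))// lerD2l.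
Qed.

(** A bounded set contains finitely many points, so the count takes natural values and each of its
    level sets is a generator of the sigma-algebra. *)
Lemma measurable_count_bounded (B : set V) : measurable B ->
  bounded_set (B : set 'rV[R]_k) ->
  measurable_fun [set: configT R k]
    (fun phi : configT R k => cntm R (pts phi : set V) B).
Proof.
move=> mB bB _ Y mY; rewrite setTI.
rewrite (_ : _ @^-1` _ = \bigcup_(n in [set n : nat | Y n%:R%:E])
   [set phi : configT R k | (pts phi `&` B #= `I_n)%card]).
  apply: bigcup_measurable => n _; apply: sub_sigma_algebra.
  by exists B, n.
apply/seteqP; split=> phi /=; rewrite cntmE.
  have /finite_setP[n phiBn] := pts_locally_finite phi bB.
  by rewrite (esum_card _ phiBn) => Yn; exists n.
by move=> [n Yn phiBn]; rewrite (esum_card _ phiBn).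
Qed.

Context d (X : measurableType d) (f : X -> configT R k)
  (mf : measurable_fun setT f).

Definition config_kernel (x : X) : {measure set V -> \bar R} :=
  cntm R (pts (f x) : set V).

Let config_kernel_ball B n : measurable B ->
  measurable_fun setT (fun x => config_kernel x (B `&` centered_ball n)).
Proof.
move=> mB; apply: (measurableT_comp (measurable_count_bounded _ _) mf).
  exact: measurableI mB (measurable_centered_ball n).
by apply: sub_bounded_set (bounded_centered_ball n) => y [].
Qed.

Let config_kernel_cvg x B : measurable B ->
  config_kernel x (B `&` centered_ball n) @[n --> \oo] --> config_kernel x B.
Proof.
move=> mB; rewrite -[B in X in _ --> X]setIT -bigcup_centered_ball setI_bigcupr.
apply: nondecreasing_cvg_mu => [n||m n mn].
- exact: measurableI mB (measurable_centered_ball n).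
- apply: bigcup_measurable => n _.
  exact: measurableI mB (measurable_centered_ball n).
- by apply/subsetPset; apply: setIS; exact: centered_ball_nd.
Qed.

Let measurable_config_kernel (B : set V) : measurable B ->
  measurable_fun setT (config_kernel ^~ B).
Proof.
move=> mB; apply: emeasurable_fun_cvg (fun n => config_kernel_ball n mB) _.
by move=> x _; exact: config_kernel_cvg.
Qed.

HB.instance Definition _ := isKernel.Build _ _ X V R config_kernel
  measurable_config_kernel.

Import HBNNSimple.

(** The tool behind the later measurability claims about sums over a random configuration: such a
    sum is an integral against [config_kernel]. *)
Lemma measurable_config_esum (G : X * V -> \bar R) :
  measurable_fun setT G -> (forall z, (0 <= G z)%E) ->
  measurable_fun setT (fun x => (\esum_(y in pts (f x)) G (x, y))%E).
Proof.
move=> mG G0.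
rewrite (_ : (fun x => _) = (fun x => \int[config_kernel x]_y G (x, y))%E).
  apply: (measurable_fun_xsection_integral _ (fun x => config_kernel x)
    (nnsfun_approx measurableT mG)).
  - by move=> a b ab; exact/nd_nnsfun_approx.
  - by move=> z; exact/cvg_nnsfun_approx.
  move=> n r; set A := _ @^-1` _; have mA : measurable A by exact: measurable_funPTI.
  apply: (emeasurable_fun_cvg (fun m x =>
    config_kernel x (xsection A x `&` centered_ball m))); last first.
    by move=> x _; apply: config_kernel_cvg; exact: measurable_xsection.
  move=> m.
  (* The kernel may have infinite mass. Restricted to a ball it is finite for each [x], as section
     measurability requires; the radius then tends to infinity. *)
  have bnd x : exists M, forall B, measurable B ->
      (mrestr (config_kernel x) (measurable_centered_ball m) B < M%:E)%E.
    have := pts_locally_finite (f x) (bounded_centered_ball m).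
    move=> /finite_setP[N fN]; exists N.+1%:R => B mB.
    rewrite /mrestr/= cntmE.
    apply: (@le_lt_trans _ _ N%:R%:E); last by rewrite lte_fin ltr_nat.
    rewrite -(esum_card _ fN) esum_mkcond [leRHS]esum_mkcond.
    apply: le_esum => y _; case: ifPn => [|_]; last by case: ifP.
    by rewrite inE => -[yx [_ yb]]; rewrite mem_set.
  by have [] := measurable_prod_subset_xsection_kernel bnd mA.
apply/funext => x; rewrite integral_cntm//.
- exact: pts_countable.
- exact: measurableT_comp mG (pair1_measurable _).
Qed.

End configurations.

(** * Averages over random shifts *)

Section periodic_integral.
Context (R : realType).
Notation mu := (@lebesgue_measure R).
Local Open Scope ereal_scope.

Lemma measurable_shift (t : R) :
  measurable_fun setT (+%R^~ t : measurableTypeR R -> measurableTypeR R).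
Proof. by apply: (@measurable_funD _ _ R). Qed.

Lemma lebesgue_measureD (t : R) (A : set R) : measurable A ->
  pushforward mu (+%R^~ t : _ -> measurableTypeR R) A = mu A.
Proof.
move=> mA; apply/esym/lebesgue_measure_unique => //.
  exact: measurable_shift.
move=> mt _ [[a b]] _ <-.
rewrite /= /pushforward.
rewrite (_ : _ @^-1` _ = `](a - t)%R, (b - t)%R]%classic); last first.
  by apply/seteqP; split=> x /=; rewrite !in_itv/= ltrBlDr lerBrDr.
rewrite !lebesgue_measure_itv/= !lte_fin ltrD2r.
by case: ifPn => // _; rewrite !EFinN/= -!EFinB; congr (_%:E); ring.
Qed.

Lemma integral_itv_shift (a b t : R) (h : R -> \bar R) :
  measurable_fun setT h -> (forall x, 0 <= h x) ->
  \int[mu]_(x in `[a, b[) h (x + t)%R = \int[mu]_(x in `[(a + t)%R, (b + t)%R[) h x.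
Proof.
move=> mh h0.
rewrite (_ : `[a, b[%classic = (+%R^~ t : _ -> measurableTypeR R) @^-1`
   `[(a + t)%R, (b + t)%R[%classic); last first.
  by apply/seteqP; split=> x /=; rewrite !in_itv/= lerD2r ltrD2r.
rewrite -[LHS](ge0_integral_pushforward (measurable_shift t))//.
  apply: eq_measure_integral => [|? A mA _]; first exact: measurable_shift.
  exact: lebesgue_measureD.
exact: measurable_funTS.
Qed.

Lemma integral_itv_split (a b c : R) (h : R -> \bar R) : (a <= b)%R -> (b <= c)%R ->
  measurable_fun setT h -> (forall x, 0 <= h x) ->
  \int[mu]_(x in `[a, c[) h x =
  \int[mu]_(x in `[a, b[) h x + \int[mu]_(x in `[b, c[) h x.
Proof.
move=> ab bc mh h0; rewrite -ge0_integral_setU//=.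
- by rewrite -itv_bndbnd_setU// bnd_simp.
- exact: measurable_funTS.
- rewrite disj_set2E; apply/eqP/seteqP; split=> // x [] /=.
  by rewrite !in_itv/= => /andP[_ xb] /andP[bx _]; move: (lt_le_trans xb bx); rewrite ltxx.
Qed.

Context (L : R) (h : R -> \bar R) (L0 : (0 < L)%R) (mh : measurable_fun setT h)
  (h0 : forall x, 0 <= h x)
  (hL : forall x (z : int), h (x + z%:~R * L)%R = h x).

(** Modulo [L] the window starts at some [t] between 0 and [L]; its part beyond [L], moved back by
    one period, fills the gap from 0 to [t]. *)
Lemma periodic_integral_window (a : R) :
  \int[mu]_(x in `[a, (a + L)%R[) h x = \int[mu]_(x in `[0%R, L[) h x.
Proof.
have small t : (0 <= t)%R -> (t <= L)%R ->
    \int[mu]_(x in `[t, (t + L)%R[) h x = \int[mu]_(x in `[0%R, L[) h x.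
  move=> t0 tL; rewrite (@integral_itv_split t L (t + L))//; last by rewrite lerDr.
  rewrite (@integral_itv_split 0 t L)// addeC; congr (_ + _).
  rewrite -{1}[L]add0r -integral_itv_shift//.
  by apply: eq_integral => x _; rewrite -[in RHS](hL x 1) mul1r.
pose z := Num.floor (a / L); pose t := (a - z%:~R * L)%R.
have := floor_itv (a / L); rewrite -/z => /andP[za az].
have t0 : (0 <= t)%R by rewrite subr_ge0 -ler_pdivlMr.
have tL : (t <= L)%R.
  rewrite lerBlDr -[X in (X + _)%R]mul1r -mulrDl -ler_pdivrMr//.
  by apply: ltW; move: az; rewrite intrD addrC.
rewrite -(small t t0 tL).
transitivity (\int[mu]_(x in `[t, (t + L)%R[) h (x + z%:~R * L)%R).
  rewrite integral_itv_shift//.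
  have -> : (t + L + z%:~R * L = t + z%:~R * L + L)%R by ring.
  by rewrite subrK.
by apply: eq_integral => x _; rewrite hL.
Qed.

Lemma periodic_integral_multiple (t : R) (m : nat) :
  \int[mu]_(x in `[t, (t + m%:R * L)%R[) h x
    = m%:R%:E * \int[mu]_(x in `[0%R, L[) h x.
Proof.
elim: m t => [|m IHm] t.
  by rewrite mul0r addr0 set_itvco0 integral_set0 mul0e.
rewrite (@integral_itv_split t (t + L))//.
- rewrite periodic_integral_window.
  have -> : (t + m.+1%:R * L = (t + L) + m%:R * L)%R by rewrite -natr1; ring.
  rewrite IHm -natr1 EFinD ge0_muleDl ?lee_fin//.
  by rewrite mul1e addeC.
- by rewrite lerDl ltW.
- by rewrite lerD2l ler_peMl ?ler1n// ltW.
Qed.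

(** A window of [m] periods, wherever it starts, averages a periodic function as one period does. *)
Lemma uniform_periodic (t : R) (m : nat) (Lm : R) (Lm0 : (0 < Lm)%R) :
  Lm = (m%:R * L)%R ->
  \int[uniform_prob Lm0]_x h (x + t)%R = \int[uniform_prob L0]_x h x.
Proof.
move=> LmE; have m0 : (0 < m%:R :> R)%R by rewrite -(pmulr_lgt0 _ L0) -LmE.
have mht : measurable_fun setT (fun x : R => h (x + t)%R).
  by apply: (measurableT_comp mh); exact: measurable_funD.
have E : \int[mu]_(x in `[0%R, Lm[) h (x + t)%R = m%:R%:E * \int[mu]_(x in `[0%R, L[) h x.
  rewrite integral_itv_shift// add0r LmE (addrC _ t).
  exact: periodic_integral_multiple.
rewrite !integral_uniform// -!integral_itv_bndo_bndc; try exact: measurable_funTS.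
rewrite E !subr0 muleA -EFinM LmE.
by congr (_%:E * _); rewrite invfM mulrAC mulVf ?mul1r// gt_eqF.
Qed.

End periodic_integral.

Section uniform_shifts.
Context (R : realType).

Lemma side_gt0 (M : nat) : 0 < 2 ^+ M :> R.
Proof. by rewrite exprn_gt0. Qed.

Definition unif (M : nat) : probability (measurableTypeR R) R :=
  uniform_prob (side_gt0 M).

Fixpoint shift_disp (k : nat) : measure_display :=
  if k is k'.+1 then ((@measurable _ (ocitv_type R)).-sigma, shift_disp k').-prod%mdisp
  else default_measure_display.

(** Nested pairs, so that Fubini splits off one coordinate at a time. Coordinates are read through
    natural numbers, with value 0 beyond the dimension. *)
Fixpoint shifts (k : nat) : measurableType (shift_disp k) :=
  if k is k'.+1 then (measurableTypeR R * shifts k')%type else unit.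

Fixpoint unif_shift (M k : nat) : probability (shifts k) R :=
  if k is k'.+1 then (unif M \x unif_shift M k')%E else dirac tt.

Fixpoint shift_coord (k : nat) : shifts k -> nat -> R :=
  if k is k'.+1 then fun u i => if i is j.+1 then shift_coord u.2 j else u.1
  else fun _ _ => 0.

Fixpoint shift_add (k : nat) : shifts k -> (nat -> R) -> shifts k :=
  if k is k'.+1 then fun u t => (u.1 + t 0%N, shift_add u.2 (fun i => t i.+1))
  else fun u _ => u.

Lemma shift_addE k (u : shifts k) t i : (i < k)%N ->
  shift_coord (shift_add u t) i = shift_coord u i + t i.
Proof. by elim: k u t i => [//|k IHk] [x u] t [|i] //= ik; rewrite IHk. Qed.

Lemma shift_add0 k (u : shifts k) t : (forall i, t i = 0) -> shift_add u t = u.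
Proof.
elim: k u t => [//|k IHk] [x u] t /= t0.
by rewrite t0 addr0 IHk// => i; exact: t0.
Qed.

Lemma measurable_shift_coord k i : measurable_fun setT (fun u : shifts k => shift_coord u i).
Proof.
elim: k i => [|k IHk] [|i] /=.
- exact: measurable_cst.
- exact: measurable_cst.
- exact: measurable_fst.
- exact: measurableT_comp (IHk i) measurable_snd.
Qed.

Lemma measurable_shift_add k t : measurable_fun setT (fun u : shifts k => shift_add u t).
Proof.
elim: k t => [|k IHk] t /=; first exact: measurable_id.
apply: measurable_fun_pair.
  exact: measurableT_comp (measurable_shift (t 0%N)) measurable_fst.
exact: measurableT_comp (IHk (fun i => t i.+1)) measurable_snd.
Qed.

Lemma unif_shift_prod (M k : nat) (c : nat -> R -> R) (a : R) :
  (forall i, measurable_fun setT (c i)) -> (forall i x, 0 <= c i x) ->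
  (forall i, (i < k)%N -> \int[unif M]_x (c i x)%:E = a%:E)%E ->
  (\int[unif_shift M k]_u (\prod_(i < k) c i (shift_coord u i))%:E = (a ^+ k)%:E)%E.
Proof.
elim: k c => [|k IHk] c mc c0 ca.
  under eq_integral do rewrite big_ord0.
  by rewrite expr0 integral_dirac// diracT mul1e.
have mprod n (c' : nat -> R -> R) : (forall i, measurable_fun setT (c' i)) ->
    measurable_fun setT (fun u : shifts n => \prod_(i < n) c' i (shift_coord u i)).
  move=> mc'; apply: measurable_prod => i _.
  by apply: (measurableT_comp (mc' i)); exact: measurable_shift_coord.
rewrite /= fubini_tonelli1//=; last first.
- by move=> u; rewrite lee_fin prodr_ge0.
- by apply/measurable_EFinP; exact: (mprod k.+1).
rewrite /fubini_F/=.
under eq_integral => x _.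
  under eq_integral => u _.
    rewrite big_ord_recl/= EFinM; over.
  rewrite ge0_integralZl//=.
  - rewrite (IHk (fun i => c i.+1))//; first over.
    by move=> i ik; exact: ca.
  - by apply/measurable_EFinP; exact: (mprod k (fun i => c i.+1)).
  - by move=> u _; rewrite lee_fin prodr_ge0.
  - by rewrite lee_fin.
rewrite ge0_integralZr//=.
- by rewrite ca// exprS EFinM.
- by apply/measurable_EFinP; exact: mc.
- by move=> x _; rewrite lee_fin.
- by rewrite lee_fin exprn_ge0// -lee_fin -(ca 0%N)// integral_ge0// => x _; rewrite lee_fin.
Qed.

Lemma integral_unif_shift_cst (M k : nat) (c : R) :
  (\int[unif_shift M k]_u c%:E = c%:E)%E.
Proof.
by rewrite integral_cst// -[X in (_ * X)%E]/(unif_shift M k setT)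
  probability_setT mule1.
Qed.

Definition shift_periodic (M k : nat) (g : shifts k -> \bar R) :=
  forall u (z : nat -> int), g (shift_add u (fun i => (z i)%:~R * 2 ^+ M)) = g u.

(** Used with [M' = M] for translations of the grid, and with [t = 0] to compare the averages for
    [M] and [M.+1]. *)
Lemma unif_shift_periodic (M M' k : nat) (g : shifts k -> \bar R) (t : nat -> R) :
  (M <= M')%N -> measurable_fun setT g -> (forall u, (0 <= g u)%E) ->
  shift_periodic M g ->
  (\int[unif_shift M' k]_u g (shift_add u t) = \int[unif_shift M k]_u g u)%E.
Proof.
move=> MM'; elim: k g t => [//|k IHk] g t mg g0 gM /=.
have mgt : measurable_fun setT (fun u : shifts k.+1 => g (shift_add u t)).
  exact: measurableT_comp mg (measurable_shift_add _).
rewrite fubini_tonelli1//= [RHS]fubini_tonelli1//= /fubini_F/=.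
have gx (x : R) : (\int[unif_shift M' k]_y g ((x + t 0%N)%R, shift_add y (fun i => t i.+1))
    = \int[unif_shift M k]_y g ((x + t 0%N)%R, y))%E.
  apply: (IHk (fun y => g ((x + t 0%N)%R, y)) (fun i => t i.+1)) => //.
    exact: measurableT_comp mg (pair1_measurable _).
  (* Periodicity in the remaining coordinates is joint periodicity with no move of the first one. *)
  move=> u z; rewrite -[RHS](gM _ (fun i => if i is j.+1 then z j else 0%Z)) /=.
  by rewrite mul0r addr0.
under eq_integral do rewrite gx.
apply: (@uniform_periodic R (2 ^+ M)
  (fun x => \int[unif_shift M k]_y g (x, y))%E _ _ _ _ _ (2 ^ (M' - M))).
- exact: measurable_fun_fubini_tonelli_F.
- by move=> x; exact: integral_ge0.
- move=> x z; apply: eq_integral => y _.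
  rewrite -[RHS](gM _ (fun i => if i is 0%N then z else 0%Z)) /= shift_add0//.
  by move=> i; rewrite mul0r.
- by rewrite natrX -exprD subnK.
Qed.

End uniform_shifts.

(** * Frostman's procedure on nested cells *)

Section lexicographic_order.
Context (R : realType) (k : nat).
Implicit Types x y z : 'rV[R]_k.

(** A total order invariant under translations, so that picking the least point of a finite cell
    commutes with shifts. *)
Definition lexlt x y := [exists i : 'I_k, (x ord0 i < y ord0 i) &&
  [forall j : 'I_k, (j < i)%N ==> (x ord0 j == y ord0 j)]].

Lemma lexltP x y : reflect (exists i : 'I_k, x ord0 i < y ord0 i /\
  forall j : 'I_k, (j < i)%N -> x ord0 j = y ord0 j) (lexlt x y).
Proof.
apply: (iffP existsP) => -[i].
  move=> /andP[xy /forallP h]; exists i; split=> // j ji.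
  by apply/eqP; move/implyP: (h j); exact.
move=> [xy h]; exists i; rewrite xy; apply/forallP => j; apply/implyP => ji.
by rewrite (h j ji).
Qed.

Lemma lexlt_irr x : ~~ lexlt x x.
Proof. by apply/negP => /lexltP[i [+ _]]; rewrite ltxx. Qed.

Lemma lexlt_trans y x z : lexlt x y -> lexlt y z -> lexlt x z.
Proof.
move=> /lexltP[i [xyi xy]] /lexltP[j [yzj yz]]; apply/lexltP.
have [ij|ji|ij] := ltngtP i j.
- exists i; split; first by rewrite -(yz i ij).
  by move=> l li; rewrite xy// yz// (ltn_trans li).
- exists j; split; first by rewrite (xy j ji).
  by move=> l lj; rewrite xy ?yz// (ltn_trans lj).
- have ij' : i = j by exact: val_inj.
  subst j; exists i; split; first exact: lt_trans xyi yzj.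
  by move=> l li; rewrite xy// yz.
Qed.

Lemma lexlt_total x y : x != y -> lexlt x y || lexlt y x.
Proof.
move=> xy; have [i0 xyi0] : exists i, x ord0 i != y ord0 i.
  apply/existsP; apply: contraNT xy; rewrite negb_exists => /forallP h.
  by apply/eqP/rowP => i; apply/eqP; rewrite -[_ == _]negbK.
case: (@arg_minnP _ i0 (fun i : 'I_k => x ord0 i != y ord0 i)
  (fun i => val i) xyi0) => i xyi imin.
have eqj (j : 'I_k) : (j < i)%N -> x ord0 j = y ord0 j.
  by move=> ji; apply/eqP; apply: contraTT ji => /imin; rewrite -leqNgt.
case: (ltgtP (x ord0 i) (y ord0 i)) xyi => // xyi _; apply/orP.
  by left; apply/lexltP; exists i.
by right; apply/lexltP; exists i; split=> // j /eqj.
Qed.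

Lemma lexlt_shift t x y : lexlt (x + t) (y + t) = lexlt x y.
Proof.
apply: eq_existsb => i; rewrite !mxE ltrD2r; congr (_ && _).
by apply: eq_forallb => j; rewrite !mxE (inj_eq (addIr _)).
Qed.

End lexicographic_order.

Lemma exists_minimal (T : eqType) (r : rel T) (s : seq T) :
  (forall x, ~~ r x x) -> (forall y x z, r x y -> r y z -> r x z) ->
  s != [::] -> exists2 y, y \in s & forall z, z \in s -> ~~ r z y.
Proof.
move=> irr tr; elim: s => [//|x [|x' s] IHs] _.
  by exists x; rewrite ?mem_head// => z; rewrite inE => /eqP ->.
have [//|y ys ymin] := IHs; have [rxy|rxy] := boolP (r x y).
  exists x; rewrite ?mem_head// => z; rewrite inE => /predU1P[->//|zs].
  by apply: contra (ymin z zs) => rzx; exact: tr rzx rxy.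
exists y; first by rewrite inE ys orbT.
by move=> z; rewrite inE => /predU1P[->//|/ymin].
Qed.

Section dyadic_weights.
Context (R : realType) (k : nat) (alpha : R).
Notation V := 'rV[R]_k.
Implicit Types (S : nat -> rel V) (phi : config R k).

Definition cell S n phi (x : V) : set V := pts phi `&` [set y | S n x y].

Definition mass S n phi (h : V -> R) (x : V) : R := \sum_(y \in cell S n phi x) h y.

Definition cap n : R := (2 ^+ n) `^ alpha.

(* Frostman's procedure. At level 0 every nonempty cell gets total mass 1, so
   that every point stays in some saturated cell. *)
Fixpoint fw S n phi (x : V) : R :=
  if n is m.+1 then
    let W := mass S n phi (fw S m phi) x in
    if cap n <= W then fw S m phi x * (cap n * W^-1) else fw S m phi x
  else (mass S 0 phi (fun=> 1) x)^-1.

(** Tests level [n.+1], just before its rescaling. Level 0 is saturated by construction and is the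
    default of [top_cell] and [top_side]. *)
Definition saturated S n phi (x : V) : bool :=
  cap n.+1 <= mass S n.+1 phi (fw S n phi) x.

(* [x] and [y] lie in the same maximal saturated cell of level at most [n];
   [top_side] is the side of that cell. *)
Fixpoint top_cell S n phi (x y : V) : bool :=
  if n is m.+1 then
    if saturated S m phi y then S n x y else top_cell S m phi x y
  else S 0%N x y.

Fixpoint top_side S n phi (y : V) : R :=
  if n is m.+1 then
    if saturated S m phi y then 2 ^+ n else top_side S m phi y
  else 1.

Definition leader S n phi (y : V) : bool :=
  `[< forall z, pts phi z -> top_cell S n phi z y -> ~~ lexlt z y >].

Lemma cap_gt0 n : 0 < cap n.
Proof. by rewrite powR_gt0// exprn_gt0. Qed.

Lemma top_side_ge1 S n phi y : 1 <= top_side S n phi y.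
Proof. by elim: n => [|n IHn] //=; case: ifP => // _; rewrite exprn_ege1// ler1n. Qed.

Section nested.
Context (S : nat -> rel V) (phi : config R k).
Hypotheses (Sxx : forall n x, S n x x) (Ssym : forall n x y, S n x y = S n y x)
  (Strans : forall n y x z, S n x y -> S n y z -> S n x z)
  (Snest : forall n x y, S n x y -> S n.+1 x y)
  (Sdist : forall n x y, S n x y -> `|x - y| <= 2 ^+ n).

Lemma finite_cell n x : finite_set (cell S n phi x).
Proof.
apply: sub_finite_set (finite_ball phi x (2 ^+ n)) => y [yphi /= xy].
by split=> //=; rewrite distrC Sdist.
Qed.

Lemma cell_eq n x y : S n x y -> cell S n phi x = cell S n phi y.
Proof.
move=> xy; apply/seteqP; split=> z [zphi /= h]; split=> //=.
  by apply: Strans h; rewrite Ssym.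
exact: Strans xy h.
Qed.

Lemma mass_eq n h x y : S n x y -> mass S n phi h x = mass S n phi h y.
Proof. by move=> xy; rewrite /mass (cell_eq xy). Qed.

Lemma saturated_eq n x y : S n.+1 x y -> saturated S n phi x = saturated S n phi y.
Proof. by move=> xy; rewrite /saturated (mass_eq _ xy). Qed.

Lemma fw_ge0 n x : 0 <= fw S n phi x.
Proof.
elim: n x => [|n IHn] x /=; first by rewrite invr_ge0; apply: fsumr_ge0.
case: ifP => // _; rewrite mulr_ge0// mulr_ge0 ?(ltW (cap_gt0 _))// invr_ge0.
exact: fsumr_ge0.
Qed.

Lemma fw_nonincr n x : fw S n.+1 phi x <= fw S n phi x.
Proof.
rewrite /=; case: ifP => // capW; rewrite ler_piMr ?fw_ge0//.
by rewrite ler_pdivrMr ?mul1r// (lt_le_trans (cap_gt0 _) capW).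
Qed.

Lemma fw_le m n x : (m <= n)%N -> fw S n phi x <= fw S m phi x.
Proof.
elim: n => [|n IHn]; first by rewrite leqn0 => /eqP ->.
rewrite leq_eqVlt => /predU1P[->//|]; rewrite ltnS => /IHn.
exact: le_trans (fw_nonincr n x).
Qed.

Lemma ler_fsum (A : set V) (f g : V -> R) : finite_set A ->
  (forall x, A x -> f x <= g x) -> \sum_(x \in A) f x <= \sum_(x \in A) g x.
Proof.
move=> fA fg; rewrite -lee_fin -!fsumEFin//; exact: lee_fsum.
Qed.

Lemma mass1_ge1 x : pts phi x -> 1 <= mass S 0 phi (fun=> 1) x.
Proof.
move=> xphi; rewrite /mass (fsbigID [set x])//=; last exact: finite_cell.
rewrite (_ : _ `&` [set x] = [set x]); last first.
  by apply/seteqP; split=> [y []//|y ->]; split=> //; split=> /=.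
by rewrite fsbig_set1 lerDl fsumr_ge0.
Qed.

Lemma fw0_le1 x : pts phi x -> fw S 0 phi x <= 1.
Proof. by move=> /mass1_ge1 h; rewrite /= invf_le1// (lt_le_trans ltr01). Qed.

(** The points of one cell of level [n.+1] see the same mass [W], so a common factor rescales the
    whole cell; in the saturated case [W] is positive because it reaches [cap n.+1]. *)
Lemma mass_fwS n x : mass S n.+1 phi (fw S n.+1 phi) x =
  if saturated S n phi x then cap n.+1 else mass S n.+1 phi (fw S n phi) x.
Proof.
rewrite {1}/mass; have [sx|sx] := boolP (saturated S n phi x).
  rewrite (eq_fsbigr (fun y => fw S n phi y *
      (cap n.+1 * (mass S n.+1 phi (fw S n phi) x)^-1))).
    rewrite -mulr_fsuml mulrCA -/(mass _ _ _ _ _) divff ?mulr1// gt_eqF//.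
    exact: lt_le_trans (cap_gt0 _) sx.
  move=> y; rewrite inE => -[_ /= xy]; rewrite -(mass_eq _ xy).
  by move: sx; rewrite /saturated => ->.
apply: eq_fsbigr => y; rewrite inE => -[_ /= xy]; rewrite -(mass_eq _ xy).
by move: sx; rewrite /saturated => /negbTE ->.
Qed.

(** Weights only decrease after level [m], so it suffices to bound the mass right after that level,
    when it has been reset to [cap m] or was already below it. *)
Lemma mass_fw_cap m n x : (m <= n)%N -> mass S m phi (fw S n phi) x <= cap m.
Proof.
move=> mn; apply: (@le_trans _ _ (mass S m phi (fw S m phi) x)).
  by apply: ler_fsum => [|y _]; [exact: finite_cell|exact: fw_le].
case: m {mn} => [|m].
  rewrite /cap expr0 powR1 /mass.
  rewrite (eq_fsbigr (fun=> 1 * (mass S 0 phi (fun=> 1) x)^-1)).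
    rewrite -mulr_fsuml -/(mass _ _ _ _ _).
    (* [x] is any point of the space: its unit cell may be empty, with mass 0. *)
    by have [->|/divff ->//] := eqVneq (mass S 0 phi (fun=> 1) x) 0; rewrite mul0r.
  by move=> y; rewrite inE => -[_ /= xy]; rewrite mul1r (mass_eq _ xy).
rewrite mass_fwS; case: ifPn => //; rewrite /saturated -ltNge; exact: ltW.
Qed.

Lemma top_cell_S n x y : top_cell S n phi x y -> S n x y.
Proof. by elim: n => [//|n IHn] /=; case: ifP => // _ /IHn /Snest. Qed.

Lemma top_cell_refl n x : top_cell S n phi x x.
Proof. by elim: n => [|n IHn] //=; case: ifP. Qed.

(** [top_cell] reads saturation at its second argument only. Symmetry holds because the two points
    share a cell at each level where the test is made, hence are saturated together. *)
Lemma top_cell_sym n x y : top_cell S n phi x y -> top_cell S n phi y x.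
Proof.
elim: n => [|n IHn] /=; first by rewrite Ssym.
case: ifPn => sy; first by move=> xy; rewrite (saturated_eq xy) sy Ssym.
move=> xy; have xy' := Snest (top_cell_S xy).
by rewrite (saturated_eq xy') (negbTE sy) IHn.
Qed.

Lemma top_cell_trans n y x z :
  top_cell S n phi x y -> top_cell S n phi y z -> top_cell S n phi x z.
Proof.
move=> xy yz; have Sxy := top_cell_S xy; have Syz := top_cell_S yz.
elim: n xy yz Sxy Syz => [|n IHn] /=.
  by move=> xy yz _ _; exact: Strans xy yz.
move=> xy yz Sxy Syz; move: xy yz; rewrite (saturated_eq Syz).
case: ifP => _ xy yz; first exact: Strans xy yz.
by apply: IHn => //; exact: top_cell_S.
Qed.

Lemma top_cell_dist n x y : top_cell S n phi x y -> `|x - y| <= top_side S n phi y.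
Proof.
elim: n => [|n IHn] /=; first by move=> /Sdist; rewrite expr0.
by case: ifP => // _ /Sdist.
Qed.

Lemma finite_top_cell n y : finite_set (pts phi `&` [set x | top_cell S n phi x y]).
Proof.
apply: sub_finite_set (finite_cell n y) => x [xphi /= /top_cell_S xy].
by split=> //=; rewrite Ssym.
Qed.

(** The maximal saturated cell of [y] got the mass side^alpha when it was rescaled, and no larger
    cell around it was rescaled afterwards. If no level saturates, level 0 has provided the mass
    1. *)
Lemma mass_top_cell n y : pts phi y ->
  \sum_(x \in pts phi `&` [set x | top_cell S n phi x y]) fw S n phi x
  = top_side S n phi y `^ alpha.
Proof.
move=> yphi; elim: n => [|n IHn].
  rewrite (_ : _ `&` _ = cell S 0 phi y); last first.
    by apply/seteqP; split=> x [xphi /= xy]; split=> //=; rewrite Ssym.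
  rewrite powR1 (eq_fsbigr (fun=> 1 * (mass S 0 phi (fun=> 1) y)^-1)).
    rewrite -mulr_fsuml -/(mass _ _ _ _ _) divff// gt_eqF//.
    exact: lt_le_trans (mass1_ge1 yphi).
  by move=> x; rewrite inE => -[_ /= xy]; rewrite mul1r (mass_eq _ xy).
have [sy|sy] := boolP (saturated S n phi y); rewrite [in RHS]/=.
  rewrite sy -/(cap n.+1).
  have := mass_fwS n y; rewrite sy => <-; rewrite /mass; apply: eq_fsbigl.
  by apply/seteqP; split=> x [xphi /=]; rewrite sy => xy; split=> //=;
    rewrite ?sy Ssym.
rewrite (negbTE sy) -IHn.
rewrite (_ : _ `&` _ = pts phi `&` [set x | top_cell S n phi x y]); last first.
  by apply/seteqP; split=> x [xphi /=]; rewrite (negbTE sy).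
apply: eq_fsbigr => x; rewrite inE => -[_ /= /top_cell_S /Snest xy].
by rewrite -/(saturated S n phi x) (saturated_eq xy) (negbTE sy).
Qed.

Lemma leader_exists n x : pts phi x ->
  exists y, [/\ pts phi y, top_cell S n phi x y & leader S n phi y].
Proof.
move=> xphi; have fT := finite_top_cell n x.
have [||//|y] := @exists_minimal _ (@lexlt R k)
  (fset_set (pts phi `&` [set z | top_cell S n phi z x])).
- exact: lexlt_irr.
- exact: lexlt_trans.
- set A := fset_set _; apply/eqP => A0; have : x \in A.
    by rewrite in_fset_set// inE; split=> //=; exact: top_cell_refl.
  by change (x \in enum_fset A -> False); rewrite A0.
rewrite in_fset_set// inE => -[yphi /= yx] ymin; exists y; split=> //.
  exact: top_cell_sym.
apply/asboolP => z zphi zy; apply: ymin; rewrite in_fset_set// inE; split=> //=.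
exact: top_cell_trans zy yx.
Qed.

Lemma leader_unique n x y y' : pts phi y -> pts phi y' ->
  top_cell S n phi x y -> top_cell S n phi x y' ->
  leader S n phi y -> leader S n phi y' -> y = y'.
Proof.
move=> yphi yphi' xy xy' /asboolP ly /asboolP ly'.
apply/eqP; apply: contraT => /lexlt_total/orP[] h.
  have := ly' y yphi; rewrite h; apply.
  by apply: top_cell_trans xy'; exact: top_cell_sym.
have := ly y' yphi'; rewrite h; apply.
by apply: top_cell_trans xy; exact: top_cell_sym.
Qed.

End nested.

(** * Covariance of the procedure *)

Section transport.
Context (S S' : nat -> rel V) (phi phi' : config R k) (t : V) (M : nat).
Hypotheses (phi't : forall x, pts phi' (x + t) <-> pts phi x)
  (S't : forall n x y, (n <= M)%N -> S' n (x + t) (y + t) = S n x y).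

Let cell_bij n x : (n <= M)%N ->
  set_bij (cell S n phi x) (cell S' n phi' (x + t)) (+%R^~ t).
Proof.
move=> nM; split.
- by move=> y [yphi /= xy]; split; [exact/phi't|rewrite /= S't].
- by move=> y z _ _ /addIr.
- move=> y; rewrite -[y](subrK t) => -[/phi't yphi /=]; rewrite S't// => xy.
  by exists (y - t).
Qed.

Lemma mass_transport n h h' x : (n <= M)%N -> (forall y, h' (y + t) = h y) ->
  mass S' n phi' h' (x + t) = mass S n phi h x.
Proof.
move=> nM hh'; rewrite /mass (reindex_fsbig _ _ _ _ (cell_bij x nM)).
by apply: eq_fsbigr => y _.
Qed.

(** Agreement of [S] and [S'] is asked up to level [M] only, to serve two purposes: moving
    configuration and grid together by [t], and, with [t = 0], moving the grid alone by multiples of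
    [2 ^+ M]. *)
Lemma fw_transport n x : (n <= M)%N -> fw S' n phi' (x + t) = fw S n phi x.
Proof.
elim: n x => [|n IHn] x nM /=.
  by rewrite (@mass_transport 0 (fun=> 1)).
by rewrite (@mass_transport _ (fw S n phi))// => [|y]; rewrite IHn// ltnW.
Qed.

Lemma saturated_transport n x : (n < M)%N ->
  saturated S' n phi' (x + t) = saturated S n phi x.
Proof.
move=> nM; rewrite /saturated (@mass_transport _ (fw S n phi))// => y.
by rewrite fw_transport// ltnW.
Qed.

Lemma top_cell_transport n x y : (n <= M)%N ->
  top_cell S' n phi' (x + t) (y + t) = top_cell S n phi x y.
Proof.
elim: n => [|n IHn] nM /=; first by rewrite S't.
by rewrite saturated_transport// S't// IHn// ltnW.
Qed.

Lemma top_side_transport n y : (n <= M)%N ->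
  top_side S' n phi' (y + t) = top_side S n phi y.
Proof.
elim: n => [|n IHn] nM //=.
by rewrite saturated_transport// IHn// ltnW.
Qed.

Lemma leader_transport n y : (n <= M)%N ->
  leader S' n phi' (y + t) = leader S n phi y.
Proof.
move=> nM; apply: asbool_equiv_eq; split=> h z zphi zy.
  rewrite -(lexlt_shift t); apply: h; first exact/phi't.
  by rewrite top_cell_transport.
move: zphi zy; rewrite -[z](subrK t) => /phi't zphi.
by rewrite top_cell_transport// lexlt_shift; exact: h.
Qed.

End transport.

End dyadic_weights.

(** * Mass of a ball in the dyadic grid *)

Section hitting_sums.
Context (R : realType) (k : nat) (T : eqType).
Context (s : seq T) (w : T -> R) (g : T -> {ffun 'I_k -> 'I_3})
  (b : T -> {ffun 'I_k -> bool}) (hit : 'I_k -> 'I_3 -> bool -> bool).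
Context (K sigma C C' : R).
Hypotheses (w_ge0 : forall x, 0 <= w x) (K_ge0 : 0 <= K) (sigma_ge0 : 0 <= sigma)
  (C'_ge0 : 0 <= C').
Hypothesis s_hit : {in s, forall x i, hit i (g x i) (b x i)}.
Hypothesis sumC : forall f, \sum_(x <- s | g x == f) w x <= C.
Hypothesis sumC' : forall f e, \sum_(x <- s | (g x == f) && (b x == e)) w x <= C'.
Hypothesis interp : forall m y, y <= C -> y <= 2 ^+ m * C' -> y <= K * sigma ^+ m.

(** In the application [j] numbers the slabs of side [2 ^+ n.+1] in direction [i], the boolean
    selects a half of the slab, and [hit] tells whether that half is within reach of the ball. *)
Definition hit_factor (i : 'I_k) (j : 'I_3) : R :=
  if hit i j false && hit i j true then sigma
  else (hit i j false || hit i j true)%:R.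

Lemma hit_factor_ge0 i j : 0 <= hit_factor i j.
Proof. by rewrite /hit_factor; case: ifP => // _; rewrite ler0n. Qed.

Let sum_fiber f : \sum_(x <- s | g x == f) w x <= K * \prod_i hit_factor i (f i).
Proof.
have [/forallP hf|] := boolP [forall i, hit i (f i) false || hit i (f i) true]; last first.
  rewrite negb_forall => /existsP[i]; rewrite negb_or => /andP[hF hT].
  rewrite big_seq_cond big1 ?mulr_ge0 ?prodr_ge0// => [j _|x /andP[xs /eqP gx]].
    exact: hit_factor_ge0.
  have := s_hit xs i; rewrite gx; case: (b x i); first by rewrite (negbTE hT).
  by rewrite (negbTE hF).
pose both := [pred i | hit i (f i) false && hit i (f i) true].
have -> : \prod_i hit_factor i (f i) = sigma ^+ #|both|.
  rewrite -prodr_const [RHS]big_mkcond; apply: eq_bigr => i _.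
  by rewrite /hit_factor hf.
apply: interp => //.
rewrite (partition_big b predT)//=.
(* A part [e] contributes only if it is hit in every coordinate. This indicator is a product over
   the coordinates, so the number of contributing parts is [2 ^+ #|both|]. *)
apply: (@le_trans _ _ (\sum_(e : {ffun 'I_k -> bool})
    (\prod_i (hit i (f i) (e i))%:R) * C')).
  apply: ler_sum => e _.
  have [/forallP he|] := boolP [forall i, hit i (f i) (e i)].
    by rewrite [X in _ <= X * _]big1 ?mul1r// => i _; rewrite he.
  rewrite negb_forall => /existsP[i he].
  rewrite big_seq_cond big1; last first.
    move=> x /and3P[xs /eqP gx /eqP bx]; move: (s_hit xs i).
    by rewrite gx bx (negbTE he).
  by rewrite mulr_ge0// prodr_ge0.
rewrite -mulr_suml -(bigA_distr_bigA (fun i (e : bool) => (hit i (f i) e)%:R : R)).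
rewrite -[X in X * _ <= _](_ : 2 ^+ #|both| = _)//.
rewrite -prodr_const [LHS]big_mkcond; apply: eq_bigr => i _.
rewrite big_bool /= !inE; move: (hf i).
by case: (hit i (f i) false); case: (hit i (f i) true) => //= _; rewrite ?addr0 ?add0r.
Qed.

(** A large cell is a choice of one slab per coordinate, so by distributivity the sum of the
    products over the cells factors. *)
Lemma hitting_sum : \sum_(x <- s) w x <= K * \prod_i \sum_j hit_factor i j.
Proof.
rewrite (partition_big g predT)//= bigA_distr_bigA mulr_sumr.
by apply: ler_sum => f _; exact: sum_fiber.
Qed.

End hitting_sums.

Section dyadic_interpolation.
Context (R : realType) (alpha r : R) (n : nat).
Hypotheses (alpha_ge0 : 0 <= alpha) (lo : 2 ^+ n <= r) (hi : r <= 2 ^+ n.+1).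

(* [m] is the number of coordinates in which both halves of a cell of level
   [n.+1] are met by a ball of radius [r]. Neither bound alone suffices for the
   constant [3 ^ k]; this interpolation is multiplicative over the coordinates
   and each coordinate contributes exactly 3 on average. *)
Lemma cap_interpolation (m : nat) (y : R) :
  y <= cap alpha n.+1 -> y <= 2 ^+ m * cap alpha n ->
  y <= r `^ alpha * (2 ^+ n.+1 / r) ^+ m.
Proof.
have n0 : 0 < 2 ^+ n :> R by rewrite exprn_gt0.
have r0 : 0 < r by exact: lt_le_trans lo.
set s := 2 ^+ n.+1 / r.
have s1 : 1 <= s by rewrite ler_pdivlMr// mul1r.
have s2 : 0 < s / 2 <= 1.
  apply/andP; split; first by rewrite divr_gt0// (lt_le_trans ltr01).
  by rewrite ler_pdivrMr// mul1r ler_pdivrMr// exprS ler_pM2l.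
(* Write s for [2 ^+ n.+1 / r], which lies between 1 and 2. If alpha <= m, the first bound suffices
   as s^alpha <= s^m; otherwise the second does, as (s/2)^alpha <= (s/2)^m. *)
move=> yC yC'; have [ma|am] := leP alpha m%:R.
  apply: le_trans yC _; rewrite /cap -[2 ^+ n.+1](divfK (lt0r_neq0 r0)).
  rewrite -/s powRM ?(ltW r0) ?(le_trans ler01)// mulrC ler_wpM2l ?powR_ge0//.
  by rewrite -powR_mulrn ?(le_trans ler01)// ler_powR.
apply: le_trans yC' _; rewrite /cap.
have -> : 2 ^+ n = r * (s / 2) :> R.
  by rewrite /s exprS; field; rewrite gt_eqF.
have /andP[s20 s21] := s2.
rewrite powRM ?(ltW r0) ?(ltW s20)// mulrCA ler_wpM2l ?powR_ge0//.
apply: (@le_trans _ _ (2 ^+ m * (s / 2) ^+ m)).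
  rewrite ler_wpM2l ?exprn_ge0// -powR_mulrn ?(ltW s20)//.
  by apply: ger_powR => //; exact: ltW.
by rewrite -exprMn mulrC divfK.
Qed.

End dyadic_interpolation.

(** The halves met occupy the positions [e] to [e + d], and slab [j] consists of the positions
    [j.*2] and [j.*2 + 1]. If N slabs and N' halves are met, then N' - N slabs are met in both
    halves and 2N - N' in one, which gives sigma (N' - N) + (2N - N'). *)
Lemma hit_count (R : realType) (sigma : R) (e d : nat) : (e < 2)%N -> (d < 5)%N ->
  \sum_(j < 3) (if (e <= j.*2 + false <= e + d)%N && (e <= j.*2 + true <= e + d)%N
     then sigma
     else ((e <= j.*2 + false <= e + d)%N || (e <= j.*2 + true <= e + d)%N)%:R)
  = (2 - sigma) * ((e + d)./2.+1)%:R + (sigma - 1) * (d.+1)%:R.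
Proof.
move=> e2 d5; rewrite !big_ord_recl big_ord0 /=.
by case: e e2 => [|[|//]] _; case: d d5 => [|[|[|[|[|//]]]]] _ /=; ring.
Qed.

(** * Geometry of the dyadic grid *)

Section grid.
Context (R : realType) (k : nat).
Notation V := 'rV[R]_k.
Implicit Types (a : nat -> R) (x y : V).

Definition grid_index n a x (i : 'I_k) : int := Num.floor ((x ord0 i - a i) / 2 ^+ n).

Definition same_cell a n x y := [forall i, grid_index n a x i == grid_index n a y i].

Lemma same_cellP a n x y :
  reflect (forall i, grid_index n a x i = grid_index n a y i) (same_cell a n x y).
Proof. by apply: (iffP forallP) => h i; apply/eqP. Qed.

Lemma same_cell_refl a n x : same_cell a n x x.
Proof. exact/same_cellP. Qed.

Lemma same_cell_sym a n x y : same_cell a n x y = same_cell a n y x.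
Proof. by apply: eq_forallb => i; rewrite eq_sym. Qed.

Lemma same_cell_trans a n y x z :
  same_cell a n x y -> same_cell a n y z -> same_cell a n x z.
Proof. by move=> /same_cellP xy /same_cellP yz; apply/same_cellP => i; rewrite xy. Qed.

(** All levels share one origin, so nesting of the cells amounts to integer halving of their
    indices. *)
Lemma floor_half (p : R) : (Num.floor (p / 2) = (Num.floor p %/ 2)%Z).
Proof.
apply: floor_def; have /andP[h1 h2] := floor_itv p.
have := divz_eq (Num.floor p) 2; have := modz_ge0 (Num.floor p) (d := 2) isT.
have := ltz_pmod (Num.floor p) (d := 2) isT.
move: (Num.floor p %/ 2)%Z (Num.floor p %% 2)%Z => q t t2 t0 E.
move: h1 h2; rewrite E !intrD intrM => h1 h2.
have t0' : 0 <= t%:~R :> R by rewrite ler0z.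
have t1' : t%:~R <= 1 :> R by rewrite -[1]/(1%:~R) ler_int -ltzD1.
apply/andP; split; first by rewrite ler_pdivlMr//; lra.
by rewrite ltr_pdivrMr//; lra.
Qed.

Lemma grid_indexS n a x i : grid_index n.+1 a x i = (grid_index n a x i %/ 2)%Z.
Proof. by rewrite /grid_index -floor_half exprSr invfM mulrA. Qed.

Lemma same_cell_nest a n x y : same_cell a n x y -> same_cell a n.+1 x y.
Proof. by move=> /same_cellP xy; apply/same_cellP => i; rewrite !grid_indexS xy. Qed.

Lemma same_cell_dist a n x y : same_cell a n x y -> `|x - y| <= 2 ^+ n.
Proof.
move=> /same_cellP xy; apply/rV_norm_le => [|i]; first by rewrite exprn_ge0.
have := xy i; rewrite /grid_index !mxE.
set p := x ord0 i; set q := y ord0 i; move=> E.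
have n0 : 0 < 2 ^+ n :> R by rewrite exprn_gt0.
have /andP[p1 p2] := floor_itv ((p - a i) / 2 ^+ n).
have /andP[q1 q2] := floor_itv ((q - a i) / 2 ^+ n).
rewrite E in p1 p2; move: p1 p2 q1 q2; rewrite !intrD.
rewrite !ler_pdivlMr// !ltr_pdivrMr// !mulrDl !mul1r.
set z := _%:~R * _ => p1 p2 q1 q2.
by rewrite ler_norml; apply/andP; split; lra.
Qed.

Lemma same_cell_shift a a' n (t x y : V) :
  (forall i : 'I_k, a' i = a i + t ord0 i) ->
  same_cell a' n (x + t) (y + t) = same_cell a n x y.
Proof.
move=> a't; apply: eq_forallb => i; rewrite /grid_index !mxE a't.
have E (p : R) : p + t ord0 i - (a i + t ord0 i) = p - a i by ring.
by rewrite !E.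
Qed.

(** [2 ^+ M] is a multiple of the side [2 ^+ n], so in each coordinate all indices of level [n]
    change by the same integer. *)
Lemma same_cell_periodic a a' n M (z : nat -> int) x y : (n <= M)%N ->
  (forall i : 'I_k, a' i = a i + (z i)%:~R * 2 ^+ M) ->
  same_cell a' n x y = same_cell a n x y.
Proof.
move=> nM a'z; apply: eq_forallb => i; rewrite /grid_index a'z.
have E (p : R) : (p - (a i + (z i)%:~R * 2 ^+ M)) / 2 ^+ n
    = (p - a i) / 2 ^+ n + (- z i * 2 ^+ (M - n))%:~R.
  rewrite -[in X in X * _](subnK nM) exprD intrM intrN rmorphXn.
  by field; rewrite expf_neq0.
by rewrite !E !floorDrz ?intr_int// !intrKfloor (inj_eq (addIr _)).
Qed.

End grid.

(** Counted in halves from the start of the slab containing [A], the index [A] sits at position [e],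
    [B] at [e + d], and [G] at [j.*2] plus its parity. *)
Lemma half_index (A B G : int) : A <= G -> G <= B -> B <= A + 4 ->
  let j := `|(G %/ 2)%Z - (A %/ 2)%Z|%N in
  let e := `|(A %% 2)%Z|%N in let d := `|B - A|%N in
  [/\ (e < 2)%N, (d < 5)%N, (j < 3)%N, (G %/ 2)%Z = (A %/ 2)%Z + j%:Z &
      (e <= j.*2 + ((G %% 2)%Z == 1) <= e + d)%N].
Proof.
move=> AG GB BA j e d; rewrite /j /e /d.
have AE := divz_eq A 2; have GE := divz_eq G 2.
have A0 := modz_ge0 A (d := 2) isT; have A2 := ltz_pmod A (d := 2) isT.
have G0 := modz_ge0 G (d := 2) isT; have G2 := ltz_pmod G (d := 2) isT.
move: (A %/ 2)%Z (A %% 2)%Z (G %/ 2)%Z (G %% 2)%Z AE GE A0 A2 G0 G2 => {j e d}.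
move=> L e Q t AE GE A0 A2 G0 G2.
have [tE|tE] : (t = 0) \/ (t = 1) by lia.
  by rewrite tE; split; lia.
by rewrite tE; split; lia.
Qed.

Lemma half_index_count (A B : int) : A <= B ->
  ((`|(A %% 2)%Z| + `|B - A|)./2)%:Z = (B %/ 2)%Z - (A %/ 2)%Z.
Proof.
move=> AB.
have AE := divz_eq A 2; have BE := divz_eq B 2.
have A0 := modz_ge0 A (d := 2) isT; have A2 := ltz_pmod A (d := 2) isT.
have B0 := modz_ge0 B (d := 2) isT; have B2 := ltz_pmod B (d := 2) isT.
move: (A %/ 2)%Z (A %% 2)%Z (B %/ 2)%Z (B %% 2)%Z AE BE A0 A2 B0 B2.
move=> L e Q t AE BE A0 A2 B0 B2; lia.
Qed.

Section ball_bound.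
Context (R : realType) (k : nat) (alpha : R) (phi : config R k) (a : nat -> R).
Notation V := 'rV[R]_k.
Notation S := (same_cell a).
Context (n M : nat) (r : R) (v : V).
Hypotheses (alpha_ge0 : 0 <= alpha) (nM : (n < M)%N) (lo : 2 ^+ n <= r)
  (hi : r <= 2 ^+ n.+1).
Notation w := (fw alpha S M phi).

(* [(2 - s) * N + (s - 1) * N'], where [N] and [N'] are the numbers of cells of
   sides [2 ^+ n.+1] and [2 ^+ n] met by the interval [[p - r, p + r]] when the
   origin of the grid is [u]. *)
Definition coord_factor (n : nat) (r p u : R) : R :=
  let s := 2 ^+ n.+1 / r in
  (2 - s) * (1 + (Num.floor ((p + r - u) / 2 ^+ n.+1)
                  - Num.floor ((p - r - u) / 2 ^+ n.+1))%:~R)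
  + (s - 1) * (1 + (Num.floor ((p + r - u) / 2 ^+ n)
                    - Num.floor ((p - r - u) / 2 ^+ n))%:~R).

Lemma sum_le_mass (N : set V) (P : pred V) m x0 : finite_set N -> N `<=` pts phi ->
  (forall x, N x -> P x -> S m x0 x) ->
  \sum_(x <- fset_set N | P x) w x <= mass S m phi w x0.
Proof.
move=> fN Nphi NP; rewrite big_mkcond/=.
rewrite (eq_bigr (fun x => if x \in [set x | P x] then w x else 0)); last first.
  by move=> x _; rewrite mem_setE.
rewrite -fsbig_finite// -fsbig_mkcondr /mass.
have fcell : finite_set (cell S m phi x0).
  exact/finite_cell/same_cell_dist.
rewrite [leRHS](fsbigID (N `&` [set x | P x]))//=.
rewrite (_ : cell S m phi x0 `&` _ = N `&` [set x | P x]); last first.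
  by apply/seteqP; split=> [x [] //|x [Nx Px]]; split=> //; split;
    [exact: Nphi|exact: NP].
by rewrite lerDl fsumr_ge0// => x _; exact: fw_ge0.
Qed.

Lemma ball_sum :
  \sum_(x \in pts phi `&` [set x | `|x - v| <= r]) w x
  <= r `^ alpha * \prod_(i < k) coord_factor n r (v ord0 i) (a i).
Proof.
have n0 : 0 < 2 ^+ n :> R by rewrite exprn_gt0.
have r0 : 0 < r by exact: lt_le_trans lo.
set N := _ `&` _.
have fN : finite_set N by exact: finite_ball.
rewrite fsbig_finite//=.
pose A (i : 'I_k) := Num.floor ((v ord0 i - r - a i) / 2 ^+ n).
pose B (i : 'I_k) := Num.floor ((v ord0 i + r - a i) / 2 ^+ n).
(* The interval has length [2 * r <= 4 * 2 ^+ n], so it meets at most five intervals of side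
   [2 ^+ n], which lie in at most three slabs. *)
have BA i : B i <= A i + 4.
  have /andP[h1 h2] := floor_itv ((v ord0 i - r - a i) / 2 ^+ n).
  rewrite -ltzD1 -[_ < _](ltr_int R); apply: le_lt_trans (floor_le _) _.
  rewrite -/(A i) -(addrA (A i)) intrD -[(4 + 1)%:~R]/(5 : R).
  move: h2 hi; rewrite -/(A i) intrD -[1%:~R]/(1 : R) exprS !ltr_pdivrMr// !mulrDl.
  move: (2 ^+ n : R) => h; move: ((A i)%:~R * h) => z; lra.
have NAB x i : N x -> A i <= grid_index n a x i <= B i.
  move=> [_ /= /(rV_norm_le _ (ltW r0)).1 /(_ i)]; rewrite !mxE ler_norml => /andP[x1 x2].
  by apply/andP; split; apply: le_floor; rewrite ler_pM2r ?invr_gt0//; lra.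
pose L i := (A i %/ 2)%Z; pose e i := `|(A i %% 2)%Z|%N; pose d i := `|B i - A i|%N.
pose g x := [ffun i => inord `|grid_index n.+1 a x i - L i|%N : 'I_3].
pose b x := [ffun i : 'I_k => (grid_index n a x i %% 2)%Z == 1].
pose hit i (j : 'I_3) (c : bool) := (e i <= j.*2 + c <= e i + d i)%N.
have key x i : N x -> grid_index n.+1 a x i = L i + (g x i)%:Z /\ hit i (g x i) (b x i).
  move=> Nx; have /andP[AG GB] := NAB x i Nx.
  have [_ _ j3 GE h] := half_index AG GB (BA i).
  by rewrite /hit !ffunE grid_indexS inordK.
have key2 x i : grid_index n a x i = grid_index n.+1 a x i * 2 + (b x i)%:Z.
  rewrite ffunE grid_indexS [LHS](divz_eq _ 2); congr (_ + _).
  have := modz_ge0 (grid_index n a x i) (d := 2) isT.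
  have := ltz_pmod (grid_index n a x i) (d := 2) isT.
  by move: (_ %% 2)%Z => t t2 t0; have [->|->] : t = 0 \/ t = 1 by lia.
have in_N x : x \in fset_set N -> N x by rewrite in_fset_set// inE.
have Nphi : N `<=` pts phi by move=> x [].
(* Points that share a cell of level [m] weigh at most [cap alpha m]. Level [n.+1] gives the
   hypothesis [sumC] of [hitting_sum], and level [n] gives [sumC']. *)
have step (P : pred V) m : (m <= M)%N ->
    (forall x y, N x -> N y -> P x -> P y -> S m x y) ->
    \sum_(x <- fset_set N | P x) w x <= cap alpha m.
  move=> mM PS; have [[x0 [Nx0 Px0]]|noP] := pselect (exists x, N x /\ P x).
    apply: le_trans (mass_fw_cap alpha _ _ _ _ x0 mM).
    - by apply: sum_le_mass => // x Nx Px; exact: PS.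
    - exact: same_cell_sym.
    - exact: same_cell_trans.
    - exact: same_cell_dist.
  rewrite big_seq_cond big_pred0 ?(ltW (cap_gt0 _ _))// => x; apply/negbTE/negP.
  by move=> /andP[/in_N Nx Px]; apply: noP; exists x.
apply: le_trans (@hitting_sum R k V (fset_set N) w g b hit (r `^ alpha)
  (2 ^+ n.+1 / r) (cap alpha n.+1) (cap alpha n) _ _ _ _ _ _ _) _.
- exact: powR_ge0.
- by rewrite divr_ge0 ?exprn_ge0// ltW.
- exact/ltW/cap_gt0.
- by move=> x /in_N Nx i; have [] := key x i Nx.
- move=> f; apply: step => // x y Nx Ny /eqP gx /eqP gy; apply/same_cellP => i.
  by rewrite (key x i Nx).1 (key y i Ny).1 gx gy.
- move=> f c; apply: step => [|x y Nx Ny]; first exact: ltnW.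
  move=> /andP[/eqP gx /eqP bx] /andP[/eqP gy /eqP b_y]; apply/same_cellP => i.
  by rewrite !key2 (key x i Nx).1 (key y i Ny).1 gx gy bx b_y.
- by move=> m y; exact: cap_interpolation.
apply: ler_wpM2l; first exact: powR_ge0.
rewrite le_eqVlt; apply/orP; left; apply/eqP; apply: eq_bigr => i _.
have AB : A i <= B i by apply: le_floor; rewrite ler_pM2r ?invr_gt0//; lra.
have [e2 d5 _ _ _] := half_index (lexx (A i)) AB (BA i).
rewrite /hit_factor /hit (hit_count _ e2 d5) /coord_factor.
(* [coord_factor] has floors at two scales, [hit_count] has parities; halving the indices of level
   [n] turns one form into the other. *)
rewrite !exprSr !invfM !mulrA -exprSr !floor_half -/(A i) -/(B i).
have -> : (`|(A i %% 2)%Z| + `|B i - A i|)./2.+1%:R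
    = 1 + ((B i %/ 2)%Z - (A i %/ 2)%Z)%:~R :> R.
  by rewrite -half_index_count// -[LHS]natr1 [LHS]addrC.
have -> : `|B i - A i|.+1%:R = 1 + (B i - A i)%:~R :> R.
  by rewrite -[in RHS](@gez0_abs (B i - A i)) ?subr_ge0// -[LHS]natr1 [LHS]addrC.
by [].
Qed.

End ball_bound.

(** * Mean number of grid intervals met by an interval *)

Section coordinate_average.
Context (R : realType).

Lemma measurable_floor : measurable_fun setT (fun x : R => (Num.floor x)%:~R : R).
Proof.
apply: nondecreasing_measurable => // x y xy.
by rewrite ler_int; exact: le_floor.
Qed.

Lemma measurable_floor_affine (p c : R) :
  measurable_fun setT (fun u : R => (Num.floor ((p - u) / c))%:~R : R).
Proof.
apply: (measurableT_comp measurable_floor).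
by apply: measurable_funM => //; apply: measurable_funB.
Qed.

Lemma integral_unif_cst (M : nat) (c : R) : (\int[unif R M]_u c%:E = c%:E)%E.
Proof. by rewrite integral_cst// -[X in (_ * X)%E]/(unif R M setT) probability_setT mule1. Qed.

(** The fractional parts of [(p - u) / 2 ^+ n] and [(q - u) / 2 ^+ n] have the same mean, since they
    are periodic in [u] and translates of each other. The difference of the floors therefore has the
    mean of the difference of the numbers. *)
Lemma unif_floor_diff (M n : nat) (p q : R) : (n <= M)%N -> q <= p ->
  (\int[unif R M]_u ((Num.floor ((p - u) / 2 ^+ n)
                      - Num.floor ((q - u) / 2 ^+ n))%:~R)%:E
   = ((p - q) / 2 ^+ n)%:E)%E.
Proof.
move=> nM qp; have n0 : 0 < 2 ^+ n :> R by rewrite exprn_gt0.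
pose fr (p u : R) : R := (p - u) / 2 ^+ n - (Num.floor ((p - u) / 2 ^+ n))%:~R.
have fr0 p' u : 0 <= fr p' u by rewrite subr_ge0 floor_le.
have fr1 p' u : fr p' u <= 1.
  rewrite lerBlDl; apply: ltW.
  by have /andP[_] := floor_itv ((p' - u) / 2 ^+ n); rewrite intrD.
have mfr p' : measurable_fun setT (fr p').
  apply: measurable_funB; last exact: measurable_floor_affine.
  by apply: measurable_funM => //; apply: measurable_funB.
have frE : (\int[unif R M]_u (fr p u)%:E = \int[unif R M]_u (fr q u)%:E)%E.
  rewrite -[RHS](@uniform_periodic R (2 ^+ M) (fun u => (fr q u)%:E) (side_gt0 R M)
    _ _ _ (q - p) 1 _ (side_gt0 R M)).
  - by apply: eq_integral => u _; rewrite /fr; congr (_%:E);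
      rewrite (_ : q - (u + (q - p)) = p - u)//; ring.
  - exact/measurable_EFinP.
  - by move=> x; rewrite lee_fin.
  - move=> x z; congr (_%:E); rewrite /fr.
    have -> : (q - (x + z%:~R * 2 ^+ M)) / 2 ^+ n
        = (q - x) / 2 ^+ n + (- z * 2 ^+ (M - n))%:~R.
      rewrite -[in X in X * _](subnK nM) exprD intrM intrN rmorphXn.
      by field; rewrite expf_neq0.
    by rewrite floorDrz ?intr_int// intrKfloor intrD; ring.
  - by rewrite mul1r.
(* Finiteness lets this mean be cancelled in the extended reals. *)
have fin_fr p' : (\int[unif R M]_u (fr p' u)%:E)%E \is a fin_num.
  rewrite ge0_fin_numE; last by apply: integral_ge0 => u _; rewrite lee_fin.
  apply: (@le_lt_trans _ _ (\int[unif R M]_u 1)%E); last first.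
    by rewrite integral_unif_cst ltry.
  apply: ge0_le_integral => //.
  - by move=> u _; rewrite lee_fin.
  - by apply/measurable_EFinP; exact: mfr.
  - by move=> u _; rewrite lee_fin.
set D := (\int[_]_u _)%E.
have mD : measurable_fun setT (fun u : R => (Num.floor ((p - u) / 2 ^+ n)
                      - Num.floor ((q - u) / 2 ^+ n))%:~R : R).
  rewrite (_ : (fun u => _) = (fun u : R => (Num.floor ((p - u) / 2 ^+ n))%:~R
      - (Num.floor ((q - u) / 2 ^+ n))%:~R)); last by apply/funext => u; rewrite intrB.
  by apply: measurable_funB; exact: measurable_floor_affine.
have D0 u : 0 <= (Num.floor ((p - u) / 2 ^+ n)
                      - Num.floor ((q - u) / 2 ^+ n))%:~R :> R.
  by rewrite ler0z subr_ge0 le_floor// ler_pM2r ?invr_gt0// lerD2r.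
have c0 : 0 <= (p - q) / 2 ^+ n by rewrite divr_ge0 ?subr_ge0// ltW.
have : (D + \int[unif R M]_u (fr p u)%:E
    = ((p - q) / 2 ^+ n)%:E + \int[unif R M]_u (fr q u)%:E)%E.
  have -> : (((p - q) / 2 ^+ n)%:E = \int[unif R M]_u ((p - q) / 2 ^+ n)%:E)%E.
    by rewrite integral_unif_cst.
  rewrite -!ge0_integralD//; try by move=> u _; rewrite lee_fin.
  - apply: eq_integral => u _; rewrite -!EFinD /fr intrB; congr (_%:E).
    by field; rewrite expf_neq0.
  - by apply/measurable_EFinP; exact: mfr.
  - by apply/measurable_EFinP; exact: mD.
  - by apply/measurable_EFinP; exact: mfr.
rewrite frE => E; have := congr1 (fun z => (z - \int[unif R M]_u (fr q u)%:E)%E) E.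
by rewrite !addeK.
Qed.

Lemma floor_diff_ge0 (n : nat) (r p u : R) : 0 <= r ->
  0 <= (Num.floor ((p + r - u) / 2 ^+ n) - Num.floor ((p - r - u) / 2 ^+ n))%:~R :> R.
Proof.
move=> r0; rewrite ler0z subr_ge0 le_floor// ler_pM2r ?invr_gt0 ?exprn_gt0//; lra.
Qed.

Lemma measurable_floor_diff (n : nat) (r p : R) : measurable_fun setT (fun u : R =>
  (Num.floor ((p + r - u) / 2 ^+ n) - Num.floor ((p - r - u) / 2 ^+ n))%:~R : R).
Proof.
under eq_fun do rewrite intrB.
by apply: measurable_funB; exact: measurable_floor_affine.
Qed.

Lemma measurable_coord_factor (n : nat) (r p : R) :
  measurable_fun setT (coord_factor n r p).
Proof.
by apply: measurable_funD; apply: measurable_funM => //; apply: measurable_funD => //;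
  exact: measurable_floor_diff.
Qed.

Section one_scale.
Context (n : nat) (r : R).
Hypotheses (lo : 2 ^+ n <= r) (hi : r <= 2 ^+ n.+1).

Let r0 : 0 < r. Proof. by apply: lt_le_trans lo; rewrite exprn_gt0. Qed.

Let s1 : 0 <= 2 ^+ n.+1 / r - 1.
Proof. by rewrite subr_ge0 ler_pdivlMr// mul1r. Qed.

Let s2 : 0 <= 2 - 2 ^+ n.+1 / r.
Proof. by rewrite subr_ge0 ler_pdivrMr// exprS ler_pM2l. Qed.

Lemma coord_factor_ge0 (p u : R) : 0 <= coord_factor n r p u.
Proof.
by rewrite addr_ge0// mulr_ge0// addr_ge0// floor_diff_ge0// ltW.
Qed.

Lemma unif_coord_factor (M : nat) (p : R) : (n < M)%N ->
  (\int[unif R M]_u (coord_factor n r p u)%:E = 3%:E)%E.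
Proof.
move=> nM; pose D m u : R := (Num.floor ((p + r - u) / 2 ^+ m)
  - Num.floor ((p - r - u) / 2 ^+ m))%:~R.
have mD m : measurable_fun setT (D m) by exact: measurable_floor_diff.
have D0 m u : 0 <= D m u by exact/floor_diff_ge0/ltW.
have ED c m : 0 <= c -> (m <= M)%N ->
    (\int[unif R M]_u (c * (1 + D m u))%:E = (c * (1 + 2 * r / 2 ^+ m))%:E)%E.
  move=> c0 mM; under eq_integral do rewrite EFinM.
  rewrite ge0_integralZl//; last 2 first.
  - by apply/measurable_EFinP; apply: measurable_funD => //; exact: mD.
  - by move=> u _; rewrite lee_fin addr_ge0.
  rewrite EFinM; congr (_ * _)%E; under eq_integral do rewrite EFinD.
  rewrite ge0_integralD//; last 2 first.
  - by move=> u _; rewrite lee_fin.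
  - by apply/measurable_EFinP; exact: mD.
  rewrite integral_unif_cst unif_floor_diff//; last by have := r0; lra.
  by rewrite -EFinD; congr (_%:E); field; rewrite expf_neq0.
rewrite /coord_factor; under eq_integral do rewrite EFinD.
rewrite ge0_integralD//.
- rewrite (ED _ n.+1)// (ED _ n)//; last exact: ltnW.
  rewrite -EFinD exprS; congr (_%:E); field.
  by rewrite ?gt_eqF// ?exprn_gt0//.
- by move=> u _; rewrite lee_fin mulr_ge0// addr_ge0// D0.
- apply/measurable_EFinP; apply: measurable_funM => //.
  by apply: measurable_funD => //; exact: mD.
- by move=> u _; rewrite lee_fin mulr_ge0// addr_ge0// D0.
- apply/measurable_EFinP; apply: measurable_funM => //.
  by apply: measurable_funD => //; exact: mD.
Qed.

End one_scale.

End coordinate_average.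

(** * Measurability of the weights *)

Section measurable_combinations.
Context d (X : measurableType d) (R : realType) (k : nat).
Notation V := (borel_rV R k).

Lemma measurable_forallb (b : 'I_k -> X -> bool) :
  (forall i, measurable_fun setT (b i)) ->
  measurable_fun setT (fun x => [forall i, b i x]).
Proof.
move=> mb; apply: pred_measurable.
rewrite (_ : [set x | _] = \bigcap_(i in [set: 'I_k]) [set x | b i x]).
  by apply: fin_bigcap_measurable => // i _; exact/measurable_pred/mb.
apply/seteqP; split=> [x /= /forallP h i _|x /= h]; first exact: h.
by apply/forallP => i; exact: h.
Qed.

Lemma measurable_existsb (b : 'I_k -> X -> bool) :
  (forall i, measurable_fun setT (b i)) ->
  measurable_fun setT (fun x => [exists i, b i x]).
Proof.
move=> mb; apply: pred_measurable.
rewrite (_ : [set x | _] = \bigcup_(i in [set: 'I_k]) [set x | b i x]).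
  by apply: fin_bigcup_measurable => // i _; exact/measurable_pred/mb.
apply/seteqP; split=> [x /= /existsP[i h]|x /= [i _ h]]; first by exists i.
by apply/existsP; exists i.
Qed.

Lemma measurable_natr (b : X -> bool) :
  measurable_fun setT b -> measurable_fun setT (fun x => (b x)%:R : R).
Proof.
move=> mb; rewrite (_ : (fun x => _) = fun x => if b x then 1 else 0 : R).
  exact: measurable_fun_ifT.
by apply/funext => x; case: (b x).
Qed.

Lemma measurable_funV_ge0 (f : X -> R) : (forall x, 0 <= f x) ->
  measurable_fun setT f -> measurable_fun setT (fun x => (f x)^-1).
Proof.
move=> f0 mf; rewrite (_ : (fun x => _) = fun x => f x `^ (-1)).
  exact: measurableT_comp (measurable_powR (-1)) mf.
by apply/funext => x; rewrite powR_inv1.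
Qed.

Lemma measurable_lexlt (f g : X -> V) :
  measurable_fun setT f -> measurable_fun setT g ->
  measurable_fun setT (fun x => lexlt (f x) (g x)).
Proof.
move=> mf mg; apply: measurable_existsb => i; apply: measurable_and.
  by apply: measurable_fun_ltr; [exact: measurableT_comp (measurable_coord i) mf
    |exact: measurableT_comp (measurable_coord i) mg].
apply: measurable_forallb => j; rewrite /implb.
have [ji|ji] := boolP (j < i)%N; last exact: measurable_cst.
by apply: measurable_fun_eqr; [exact: measurableT_comp (measurable_coord j) mf
    |exact: measurableT_comp (measurable_coord j) mg].
Qed.

Lemma measurable_same_cell n (u : X -> shifts R k) (f g : X -> V) :
  measurable_fun setT u -> measurable_fun setT f -> measurable_fun setT g ->
  measurable_fun setT (fun x => same_cell (shift_coord (u x)) n (f x) (g x)).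
Proof.
move=> mu mf mg; apply: measurable_forallb => i.
rewrite (_ : (fun x => _) = fun x =>
    (grid_index n (shift_coord (u x)) (f x) i)%:~R
    == (grid_index n (shift_coord (u x)) (g x) i)%:~R :> R); last first.
  by apply/funext => x; rewrite eqr_int.
have mh (h : X -> V) : measurable_fun setT h -> measurable_fun setT
    (fun x => (grid_index n (shift_coord (u x)) (h x) i)%:~R : R).
  move=> mh; apply: (measurableT_comp (@measurable_floor R)).
  apply: measurable_funM => //; apply: measurable_funB.
    exact: measurableT_comp (measurable_coord i) mh.
  exact: measurableT_comp (@measurable_shift_coord R k i) mu.
by apply: measurable_fun_eqr; exact: mh.
Qed.

End measurable_combinations.

Section joint_measurability.
Context (R : realType) (k : nat) (alpha : R).
Notation V := (borel_rV R k).
Notation U := (shifts R k).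
Notation C := (configT R k).

Notation S u := (same_cell (shift_coord u)).

Let Sdist (u : U) n (x y : 'rV[R]_k) : S u n x y -> `|x - y| <= 2 ^+ n.
Proof. exact: same_cell_dist. Qed.

Lemma fsbig_pred_esum (phi : config R k) (b : pred 'rV[R]_k) (h : 'rV[R]_k -> R) :
  finite_set (pts phi `&` [set y | b y]) -> (forall y, 0 <= h y) ->
  (\sum_(y \in pts phi `&` [set y | b y]) h y)%:E
  = (\esum_(y in pts phi) ((b y)%:R * h y)%:E)%E.
Proof.
move=> fA h0; rewrite -fsumEFin// -esum_fset//; last first.
  by move=> y _; rewrite lee_fin.
rewrite esum_mkcondr; apply: eq_esum => y _.
have [yb|yb] := boolP (b y); first by rewrite mem_set//= mul1r.
by rewrite memNset ?mul0r//=; exact/negP.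
Qed.

(** The cell varies with the configuration and the shift; putting its indicator inside a sum over
    all points brings the mass under [measurable_config_esum]. *)
Lemma measurable_mass n (h : C * U * V -> R) : measurable_fun setT h ->
  (forall z, 0 <= h z) ->
  measurable_fun setT (fun z : C * U * V =>
    mass (S z.1.2) n z.1.1 (fun y => h (z.1, y)) z.2).
Proof.
move=> mh h0; apply/measurable_EFinP.
rewrite (_ : _ \o _ = fun z : C * U * V => (\esum_(y in pts z.1.1)
    ((S z.1.2 n z.2 y)%:R * h (z.1, y))%:E)%E); last first.
  by apply/funext => z; rewrite /= fsbig_pred_esum//; exact/finite_cell/Sdist.
apply: (@measurable_config_esum R k _ _ (fun z : C * U * V => z.1.1) _
  (fun p : C * U * V * V => ((S p.1.1.2 n p.1.2 p.2)%:R * h (p.1.1, p.2))%:E)).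
- exact: measurableT_comp measurable_fst measurable_fst.
- apply/measurable_EFinP; apply: measurable_funM.
    apply: measurable_natr; apply: measurable_same_cell.
    + apply: measurableT_comp measurable_snd _.
      exact: measurableT_comp measurable_fst measurable_fst.
    + exact: measurableT_comp measurable_snd measurable_fst.
    + exact: measurable_snd.
  apply: (measurableT_comp mh); apply: measurable_fun_pair.
    exact: measurableT_comp measurable_fst measurable_fst.
  exact: measurable_snd.
- by move=> p; rewrite lee_fin mulr_ge0// ler0n.
Qed.

Lemma measurable_fw n : measurable_fun setT (fun z : C * U * V =>
  fw alpha (S z.1.2) n z.1.1 z.2).
Proof.
elim: n => [|n IHn] /=.
  apply: measurable_funV_ge0; first by move=> z; apply: fsumr_ge0.
  exact: (@measurable_mass 0 (fun=> 1)).
have mW := measurable_mass n.+1 IHn (fun z => fw_ge0 _ _ _ _ _).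
apply: measurable_fun_ifT => //.
  exact: measurable_fun_ler.
apply: measurable_funM => //; apply: measurable_funM => //.
by apply: measurable_funV_ge0 => // z; apply: fsumr_ge0 => y _; exact: fw_ge0.
Qed.

Lemma measurable_saturated n : measurable_fun setT (fun z : C * U * V =>
  saturated alpha (S z.1.2) n z.1.1 z.2).
Proof.
have mW := measurable_mass n.+1 (measurable_fw n) (fun z => fw_ge0 _ _ _ _ _).
exact: measurable_fun_ler.
Qed.

Lemma measurable_top_cell n : measurable_fun setT (fun z : C * U * V * V =>
  top_cell alpha (S z.1.1.2) n z.1.1.1 z.1.2 z.2).
Proof.
have mS m : measurable_fun setT (fun z : C * U * V * V => S z.1.1.2 m z.1.2 z.2).
  apply: measurable_same_cell.
  - apply: measurableT_comp measurable_snd _.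
    exact: measurableT_comp measurable_fst measurable_fst.
  - exact: measurableT_comp measurable_snd measurable_fst.
  - exact: measurable_snd.
elim: n => [|n IHn] /=; first exact: mS.
apply: measurable_fun_ifT => //.
have mp : measurable_fun setT (fun z : C * U * V * V => (z.1.1, z.2)).
  apply: measurable_fun_pair; last exact: measurable_snd.
  exact: measurableT_comp measurable_fst measurable_fst.
exact: measurableT_comp (measurable_saturated n) mp.
Qed.

Lemma measurable_top_side n : measurable_fun setT (fun z : C * U * V =>
  top_side alpha (S z.1.2) n z.1.1 z.2).
Proof.
elim: n => [|n IHn] /=; first exact: measurable_cst.
by apply: measurable_fun_ifT => //; exact: measurable_saturated.
Qed.

(** A universal statement over the points of a varying configuration is not an intersection over a
    fixed index set. It is rephrased as the vanishing of a sum: the number of competitors of the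
    point. *)
Lemma measurable_leader n : measurable_fun setT (fun z : C * U * V =>
  leader alpha (S z.1.2) n z.1.1 z.2).
Proof.
pose G (z : C * U * V * V) : \bar R :=
  ((top_cell alpha (S z.1.1.2) n z.1.1.1 z.2 z.1.2 && lexlt z.2 z.1.2)%:R)%:E.
have G0 z : (0 <= G z)%E by rewrite lee_fin ler0n.
apply: pred_measurable.
rewrite (_ : [set z | _] = [set z | (\esum_(y in pts z.1.1) G (z, y) <= 0)%E]).
  rewrite -[X in measurable X]setTI; apply: emeasurable_fun_infty_c => //.
  apply: (@measurable_config_esum R k _ _ (fun z : C * U * V => z.1.1)) => //.
    exact: measurableT_comp measurable_fst measurable_fst.
  apply/measurable_EFinP; apply: measurable_natr; apply: measurable_and.
    have mp : measurable_fun setT (fun z : C * U * V * V => (z.1.1, z.2, z.1.2)).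
      apply: measurable_fun_pair; last exact: measurableT_comp measurable_snd measurable_fst.
      apply: measurable_fun_pair; last exact: measurable_snd.
      exact: measurableT_comp measurable_fst measurable_fst.
    exact: measurableT_comp (measurable_top_cell n) mp.
  by apply: measurable_lexlt; [exact: measurable_snd
    |exact: measurableT_comp measurable_snd measurable_fst].
apply/seteqP; split=> -[[phi u] y] /=.
  move=> /asboolP h; rewrite esum1// => z zphi; rewrite /G /=.
  by case: (boolP (top_cell _ _ _ _ _ _)) => //= /(h z zphi)/negbTE ->.
move=> h; apply/asboolP => z zphi zy; apply/negP => zly.
have : (1%:E <= \esum_(x in pts phi) G (phi, u, y, x))%E.
  apply: esum_ge; exists [set z].
    by split; [exact: finite_set1|move=> _ ->].
  by rewrite fsbig_set1 /G/= zy zly.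
by move=> /le_trans/(_ h); rewrite lee_fin ler10.
Qed.

End joint_measurability.

(** * Weights averaged over the shifts *)

Lemma dyadic_scale (R : realType) (r : R) : 1 <= r ->
  exists n, 2 ^+ n <= r /\ r <= 2 ^+ n.+1.
Proof.
move=> r1; have r0 : 0 <= r by exact: le_trans r1.
have m0 : (0 < Num.truncn r)%N by rewrite truncn_gt0.
have /andP[h1 h2] := trunc_log_bounds (isT : (1 < 2)%N) m0.
have /andP[t1 t2] := truncn_itv r0.
exists (trunc_log 2 (Num.truncn r)); split.
  by apply: le_trans t1; rewrite -natrX ler_nat.
by apply/ltW/(lt_le_trans t2); rewrite -natrX ler_nat.
Qed.

Section averaged_weights.
Context (R : realType) (k : nat) (alpha : R).
Hypothesis alpha_ge0 : 0 <= alpha.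
Notation V := (borel_rV R k).
Notation U := (shifts R k).
Notation C := (configT R k).
Notation S u := (same_cell (shift_coord u)).
Implicit Types (phi : config R k) (x t v : 'rV[R]_k).

(** Extends [t] by 0 to all natural indices, the format of [shift_add]. *)
Definition vcoord (t : 'rV[R]_k) (i : nat) : R :=
  if insub i is Some j then t ord0 j else 0.

Lemma vcoordE t (i : 'I_k) : vcoord t i = t ord0 i.
Proof. by rewrite /vcoord valK. Qed.

Lemma grid_shift (u : U) t n x y :
  S (shift_add u (vcoord t)) n (x + t) (y + t) = S u n x y.
Proof. by apply: same_cell_shift => i; rewrite shift_addE// vcoordE. Qed.

Lemma grid_periodic (u : U) n M (z : nat -> int) x y : (n <= M)%N ->
  S (shift_add u (fun i => (z i)%:~R * 2 ^+ M)) n (x + 0) (y + 0) = S u n x y.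
Proof.
move=> nM; rewrite !addr0; apply: (same_cell_periodic _ _ nM) => i.
by rewrite shift_addE.
Qed.

Lemma config_shiftP t phi x : pts (config_shift t phi) (x + t) <-> pts phi x.
Proof. by rewrite /= addrK. Qed.

Lemma pts_add0 phi x : pts phi (x + 0) <-> pts phi x.
Proof. by rewrite addr0. Qed.

(** The bound holds off the configuration too: level 0 gives the reciprocal of the number of points
    in the unit cell, and [0^-1 = 0] when that cell is empty. *)
Lemma fw_le1_all (u : U) n phi x : fw alpha (S u) n phi x <= 1.
Proof.
apply: (@le_trans _ _ (fw alpha (S u) 0 phi x)); first exact: fw_le.
have [[y [yphi xy]]|no] := pselect (exists y, cell (S u) 0 phi x y).
  rewrite /= (@mass_eq _ _ (S u) phi _ _ 0 _ x y)//.
  - apply: (@fw0_le1 _ _ alpha (S u)) => //.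
    + exact: same_cell_refl.
    + exact: same_cell_dist.
  - exact: same_cell_sym.
  - exact: same_cell_trans.
rewrite /= /mass (_ : cell _ _ _ _ = set0) ?fsbig_set0 ?invr0//.
by apply/seteqP; split=> // y hy; apply: no; exists y.
Qed.

Definition mean_weight M phi x : R :=
  fine (\int[unif_shift R M k]_u (fw alpha (S u) M phi x)%:E)%E.

Lemma measurable_fw_shift n phi x :
  measurable_fun setT (fun u : U => fw alpha (S u) n phi x).
Proof.
have mp : measurable_fun setT (fun u : U => ((phi : C), u, (x : V))).
  apply: measurable_fun_pair; last exact: measurable_cst.
  exact: measurable_fun_pair.
exact: measurableT_comp (measurable_fw alpha n) mp.
Qed.

Lemma integral_le1 (f : U -> R) M : measurable_fun setT f ->
  (forall u, 0 <= f u) -> (forall u, f u <= 1) ->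
  (\int[unif_shift R M k]_u (f u)%:E <= 1)%E.
Proof.
move=> mf f0 f1; apply: (@le_trans _ _ (\int[unif_shift R M k]_u 1)%E).
  apply: ge0_le_integral => //.
  - by move=> u _; rewrite lee_fin.
  - exact/measurable_EFinP.
  - by move=> u _; rewrite lee_fin.
by rewrite integral_unif_shift_cst.
Qed.

Lemma mean_weightE M phi x : (mean_weight M phi x)%:E
  = (\int[unif_shift R M k]_u (fw alpha (S u) M phi x)%:E)%E.
Proof.
rewrite /mean_weight fineK// ge0_fin_numE; last first.
  by apply: integral_ge0 => u _; rewrite lee_fin fw_ge0.
apply: (@le_lt_trans _ _ 1%E); last exact: ltry.
apply: integral_le1; first exact: measurable_fw_shift.
  by move=> u; exact: fw_ge0.
by move=> u; exact: fw_le1_all.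
Qed.

Lemma measurable_mean_weight M :
  measurable_fun setT (fun z : C * V => mean_weight M z.1 z.2).
Proof.
apply/measurable_EFinP.
rewrite (_ : _ \o _ = fun z : C * V =>
    (\int[unif_shift R M k]_u (fw alpha (S u) M z.1 z.2)%:E)%E); last first.
  by apply/funext => z; rewrite /= mean_weightE.
apply: (measurable_fun_fubini_tonelli_F (fun p : C * V * U =>
  (fw alpha (S p.2) M p.1.1 p.1.2)%:E)).
  apply/measurable_EFinP.
  have mp : measurable_fun setT (fun p : C * V * U => (p.1.1, p.2, p.1.2)).
    apply: measurable_fun_pair; last exact: measurableT_comp measurable_snd measurable_fst.
    apply: measurable_fun_pair; last exact: measurable_snd.
    exact: measurableT_comp measurable_fst measurable_fst.
  exact: measurableT_comp (measurable_fw alpha M) mp.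
by move=> p; rewrite lee_fin fw_ge0.
Qed.

Lemma mean_weight_ge0 M phi x : 0 <= mean_weight M phi x.
Proof. by rewrite -lee_fin mean_weightE integral_ge0// => u _; rewrite lee_fin fw_ge0. Qed.

Lemma mean_weight_le1 M phi x : mean_weight M phi x <= 1.
Proof.
rewrite -lee_fin mean_weightE; apply: integral_le1; first exact: measurable_fw_shift.
  by move=> u; exact: fw_ge0.
by move=> u; exact: fw_le1_all.
Qed.

Lemma fw_periodic n phi x : shift_periodic n
  (fun u : U => (fw alpha (S u) n phi x)%:E).
Proof.
move=> u z; congr (_%:E); rewrite -[x in LHS]addr0.
apply: (@fw_transport _ _ _ (S u) _ phi phi 0 n) => //.
  exact: pts_add0.
by move=> m y y' mn; exact: grid_periodic.
Qed.

(** The two averages use different laws of [u]. Periodicity first replaces the box of side [2 ^+ M]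
    by that of side [2 ^+ M.+1]; the integrands are then compared pointwise. *)
Lemma mean_weight_nonincr M phi x : mean_weight M.+1 phi x <= mean_weight M phi x.
Proof.
rewrite -lee_fin !mean_weightE.
rewrite -(@unif_shift_periodic R M M.+1 k
    (fun u => (fw alpha (S u) M phi x)%:E) (fun=> 0))//; last 3 first.
- by apply/measurable_EFinP; exact: measurable_fw_shift.
- by move=> u; rewrite lee_fin fw_ge0.
- exact: fw_periodic.
apply: ge0_le_integral => //.
- by move=> u _; rewrite lee_fin fw_ge0.
- by apply/measurable_EFinP; exact: measurable_fw_shift.
- apply/measurable_EFinP; apply: measurableT_comp (measurable_fw_shift M phi x) _.
  exact: measurable_shift_add.
- by move=> u _; rewrite shift_add0// lee_fin fw_nonincr.
Qed.

(** Moving configuration and grid together changes no weight, and moving the grid alone does not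
    affect the average of a periodic function. *)
Lemma mean_weight_shift M t phi x :
  mean_weight M (config_shift t phi) (x + t) = mean_weight M phi x.
Proof.
rewrite /mean_weight; congr fine.
rewrite -[LHS](@unif_shift_periodic R M M k _ (vcoord t))//; last 3 first.
- by apply/measurable_EFinP; exact: measurable_fw_shift.
- by move=> u; rewrite lee_fin fw_ge0.
- exact: fw_periodic.
apply: eq_integral => u _; congr (_%:E).
apply: (@fw_transport _ _ _ (S u) _ phi _ t M) => //.
  exact: config_shiftP.
by move=> n y y' _; exact: grid_shift.
Qed.

(** [n < M] ensures that level [n.+1] has been processed. The coordinates of [u] are independent, so
    averaging [ball_sum] replaces each coordinate factor by its mean 3. *)
Lemma mean_weight_ball M n phi v r : (n < M)%N -> 2 ^+ n <= r -> r <= 2 ^+ n.+1 ->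
  \sum_(x \in pts phi `&` [set x | `|x - v| <= r]) mean_weight M phi x
  <= 3 ^+ k * r `^ alpha.
Proof.
move=> nM lo hi; have fN := finite_ball phi v r.
rewrite -lee_fin -fsumEFin// EFinM.
under eq_fsbigr do rewrite mean_weightE.
rewrite -ge0_integral_fsum//; last 2 first.
- by move=> x; apply/measurable_EFinP; exact: measurable_fw_shift.
- by move=> x u _; rewrite lee_fin fw_ge0.
have mc i : measurable_fun setT (coord_factor n r (vcoord v i)).
  exact: measurable_coord_factor.
have c0 i u : 0 <= coord_factor n r (vcoord v i) u by exact: coord_factor_ge0.
have := @unif_shift_prod R M k (fun i => coord_factor n r (vcoord v i)) 3 mc c0.
move=> /(_ (fun i _ => unif_coord_factor lo hi (vcoord v i) nM)) <-.
have mprod : measurable_fun setT (fun u : U =>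
    (\prod_(i < k) coord_factor n r (vcoord v i) (shift_coord u i))).
  apply: measurable_prod => i _.
  by apply: (measurableT_comp (mc i)); exact: measurable_shift_coord.
rewrite muleC -ge0_integralZl//; last 3 first.
- exact/measurable_EFinP.
- by move=> u _; rewrite lee_fin prodr_ge0.
- by rewrite lee_fin powR_ge0.
apply: ge0_le_integral => //.
- by move=> u _; rewrite fsumEFin// lee_fin fsumr_ge0// => x _; exact: fw_ge0.
- apply: emeasurable_fsum => // x.
  by apply/measurable_EFinP; exact: measurable_fw_shift.
- by apply/measurable_EFinP; apply: measurable_funM.
move=> u _; rewrite fsumEFin// -EFinM lee_fin.
apply: le_trans (ball_sum phi _ v alpha_ge0 nM lo hi) _.
by under eq_bigr do rewrite -vcoordE.
Qed.

Definition limit_weight phi x : R := limn (fun M => mean_weight M phi x).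

Lemma mean_weight_cvg phi x :
  mean_weight M phi x @[M --> \oo] --> limit_weight phi x.
Proof.
apply: nonincreasing_is_cvgn.
  by apply/nonincreasing_seqP => M; exact: mean_weight_nonincr.
by exists 0 => _ [M _ <-]; exact: mean_weight_ge0.
Qed.

Lemma limit_weight_ge0 phi x : 0 <= limit_weight phi x.
Proof.
apply: limr_ge; first by apply/cvg_ex; exists (limit_weight phi x); exact: mean_weight_cvg.
by apply: nearW => M; exact: mean_weight_ge0.
Qed.

Lemma measurable_limit_weight :
  measurable_fun setT (fun z : C * V => limit_weight z.1 z.2).
Proof.
apply: measurable_fun_cvg measurable_mean_weight _ => z _.
exact: mean_weight_cvg.
Qed.

Lemma limit_weight_shift t phi x :
  limit_weight (config_shift t phi) (x + t) = limit_weight phi x.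
Proof.
by rewrite /limit_weight; under eq_fun do rewrite mean_weight_shift.
Qed.

(** The scale [n] depends on [r] only, so one bound holds for all large [M], and it passes to the
    limit of a finite sum. *)
Lemma limit_weight_ball phi v r : 1 <= r ->
  \sum_(x \in pts phi `&` [set x | `|x - v| <= r]) limit_weight phi x
  <= 3 ^+ k * r `^ alpha.
Proof.
move=> r1; have fN := finite_ball phi v r; have [n [lo hi]] := dyadic_scale r1.
have cv : (\sum_(x \in pts phi `&` [set x | `|x - v| <= r]) mean_weight M phi x)
    @[M --> \oo] --> \sum_(x \in pts phi `&` [set x | `|x - v| <= r]) limit_weight phi x.
  rewrite fsbig_finite//=; under eq_fun do rewrite fsbig_finite//=.
  by apply: cvg_big => [|x _]; [exact: add_continuous|exact: mean_weight_cvg].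
rewrite -(cvg_lim _ cv)//; apply: limr_le; first by apply/cvg_ex; eexists; exact: cv.
near=> M; apply: (@mean_weight_ball M n) => //; near: M.
exact: nbhs_infty_gt.
Unshelve. all: by end_near. Qed.

End averaged_weights.

(** * Random markings *)

Lemma countable_bigcap_measurable d (X : measurableType d) (T : pointedType)
    (D : set T) (F : T -> set X) : countable D ->
  (forall i, D i -> measurable (F i)) -> measurable (\bigcap_(i in D) F i).
Proof.
move=> /countable_bijP[B]; rewrite card_eq_sym => /card_set_bijP[e [eB _ eD]] mF.
rewrite (_ : D = e @` B); last first.
  by apply/seteqP; split=> [x /eD //|_ [j Bj <-]]; exact: eB.
rewrite bigcap_image; apply: bigcap_measurableType => j Bj; exact/mF/eB.
Qed.

Lemma countable_bigcup_measurable d (X : measurableType d) (T : pointedType)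
    (D : set T) (F : T -> set X) : countable D ->
  (forall i, D i -> measurable (F i)) -> measurable (\bigcup_(i in D) F i).
Proof.
move=> cD mF; rewrite -[X in measurable X]setCK setC_bigcup.
by apply/measurableC/countable_bigcap_measurable => // i /mF; exact: measurableC.
Qed.

Section marked_configurations.
Context (R : realType) (k : nat).
Notation V := (borel_rV R k).
Notation C := (configT R k).
Implicit Types (phi : config R k) (m : 'rV[R]_k -> R) (z : marked_config R k).

(** The mark of a point sits at its diagonal pair; the other pairs carry 0, a value that the mark
    space must allow. *)
Definition diag_mark phi m (x y : 'rV[R]_k) : R :=
  if `[< pts phi x /\ x = y >] then m x else 0.

Lemma diag_mark_out phi m x y : ~ (pts phi x /\ pts phi y) -> diag_mark phi m x y = 0.
Proof.
by move=> h; rewrite /diag_mark; case: asboolP => // -[xphi xy]; subst y; case: h.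
Qed.

Definition diag_marking phi m : marked_config R k :=
  MarkedConfig (@diag_mark_out phi m).

Lemma pmark_diag phi m x : pts phi x -> pmark (diag_marking phi m) x = m x.
Proof. by move=> xphi; rewrite /pmark/= /diag_mark; case: asboolP => // -[]. Qed.

Lemma marked_config_eq z z' : ground z = ground z' -> mark z = mark z' -> z = z'.
Proof.
case: z z' => [phi mk o] [phi' mk' o'] /= E E'; subst phi' mk'.
by congr MarkedConfig; exact: Prop_irrelevance.
Qed.

Lemma diag_marking_shift (t : 'rV[R]_k) phi m m' :
  (forall x, pts phi x -> m' (x + t) = m x) ->
  diag_marking (config_shift t phi) m' = marked_shift t (diag_marking phi m).
Proof.
move=> mm'; apply: marked_config_eq => //=.
apply/funext => x; apply/funext => y; rewrite /diag_mark/=.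
rewrite (@asbool_equiv_eq (pts phi (x - t) /\ x = y)
  (pts phi (x - t) /\ x - t = y - t)); last first.
  by split=> -[xphi xy]; split=> //; [rewrite xy|exact: addIr xy].
by case: asboolP => // -[xphi _]; rewrite -mm'// subrK.
Qed.

Notation pairs z B1 B2 D := [set u : 'rV[R]_k * 'rV[R]_k |
  [/\ pts (ground z) u.1 /\ B1 u.1, pts (ground z) u.2 /\ B2 u.2 &
     D (mark z u.1 u.2)]].

Lemma measurable_no_pair (B1 B2 : set V) (D : set R) :
  measurable B1 -> bounded_set (B1 : set 'rV[R]_k) ->
  measurable B2 -> bounded_set (B2 : set 'rV[R]_k) -> measurable D ->
  measurable [set z : markedT R k | pairs z B1 B2 D = set0].
Proof.
move=> mB1 bB1 mB2 bB2 mD; apply: sub_sigma_algebra; exists B1, B2, D, 0%N; split=> //.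
by apply/seteqP; split=> z /=; rewrite II0 card_eq0 => /eqP.
Qed.

(** Counting pairs in the singletons of [x] and [y] detects a mark in [D], but an absent pair has
    mark 0 as well. Hence 0 is first kept out of [D], and the other case follows by complement. *)
Lemma measurable_mark (x y : 'rV[R]_k) :
  measurable_fun setT (fun z : markedT R k => mark z x y).
Proof.
have mE (D : set R) : measurable D -> ~ D 0 ->
    measurable [set z : markedT R k | D (mark z x y)].
  move=> mD D0.
  rewrite (_ : [set z : markedT R k | D (mark z x y)] = ~` [set z : markedT R k |
     pairs z [set x] [set y] D = set0]); last first.
    apply/seteqP; split=> z /=.
      move=> Dz E; have [[xz yz]|nxy] := pselect (pts (ground z) x /\ pts (ground z) y).
        by have : set0 (x, y) by rewrite -E.
      by apply: D0; rewrite -(mark_out nxy).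
    move=> /eqP/set0P[[x' y'] /= [[_ ->] [_ ->]]]; exact.
  apply: measurableC; apply: measurable_no_pair => //.
  - exact: measurable_rV1.
  - exact: bounded_rV1.
  - exact: measurable_rV1.
  - exact: bounded_rV1.
move=> _ D mD; rewrite setTI.
have [D0|D0] := pselect (D 0); last exact: mE.
rewrite -[X in measurable X]setCK; apply: measurableC.
by apply: (mE (~` D)); [exact: measurableC|exact].
Qed.

Lemma measurable_pts phi : measurable (pts phi : set V).
Proof.
rewrite (_ : pts phi = \bigcup_(x in pts phi) [set x]).
  by apply: countable_bigcup_measurable => [|x _];
    [exact: pts_countable|exact: measurable_rV1].
by apply/seteqP; split=> [x xphi|_ [x xphi ->]//]; exists x.
Qed.

(** Every point of [phi] must be counted, and none may be counted outside [phi] in any centered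
    ball: countably many conditions on counts. *)
Lemma measurable_ground phi : measurable [set z : markedT R k | ground z = phi].
Proof.
have config_eq (psi psi' : config R k) : pts psi = pts psi' -> psi = psi'.
  case: psi psi' => [A h] [A' h'] /= E; subst A'.
  by congr Config; exact: Prop_irrelevance.
rewrite (_ : [set z : markedT R k | _] =
  \bigcap_(x in pts phi) ~` [set z | pairs z [set x] [set x] setT = set0] `&`
  \bigcap_n [set z | pairs z (@centered_ball R k n `\` pts phi)
                             (@centered_ball R k n `\` pts phi) setT = set0]).
  apply: measurableI.
    apply: countable_bigcap_measurable => [|x _]; first exact: pts_countable.
    by apply: measurableC; apply: measurable_no_pair => //;
      try exact: measurable_rV1; exact: bounded_rV1.
  apply: bigcapT_measurable => n.
  have mB : measurable (@centered_ball R k n `\` pts phi).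
    by apply: measurableD; [exact: measurable_centered_ball|exact: measurable_pts].
  have bB : bounded_set (@centered_ball R k n `\` pts phi : set 'rV[R]_k).
    apply: (@sub_bounded_set R k _ (@centered_ball R k n)) => [y []//|].
    exact: bounded_centered_ball.
  exact: measurable_no_pair.
apply/seteqP; split=> z /=.
  move=> <-; split.
    by move=> x xz E; have : set0 (x, x) by rewrite -E.
  by move=> n _; apply/seteqP; split=> // -[x y] /= [[xz [_]]].
move=> [h1 h2]; apply: config_eq; apply/seteqP; split=> x.
  move=> xz; apply: contrapT => xphi.
  have [n _ xn] : (\bigcup_n @centered_ball R k n) x by rewrite bigcup_centered_ball.
  by have : set0 (x, x) by rewrite -(h2 n I).
move=> xphi; have /eqP/set0P[[x' y'] /=] := h1 x xphi.
by move=> [[x'z x'x] _ _]; rewrite -x'x.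
Qed.

Context d (X : measurableType d) (f : X -> C) (m : X * V -> R)
  (mf : measurable_fun setT f) (mm : measurable_fun setT m).

Lemma measurable_diag_marking : measurable_fun setT
  (fun x : X => diag_marking (f x) (fun y => m (x, y)) : markedT R k).
Proof.
apply: (@measurability _ _ X (markedT R k) setT _ (@marked_count R k)) => //.
move=> _ [_ [B1 [B2 [D [n [[mB1 bB1] [mB2 bB2] mD ->]]]]] <-].
(* The number of pairs becomes a double sum of [G] over the configuration. Equality of points is
   tested coordinate by coordinate, which makes it measurable in the pair. *)
pose G (p : X * V * V) : \bar R := (\1_B1 p.1.2 * \1_B2 p.2 *
  \1_D (if [forall i, (p.1.2 : 'rV[R]_k) ord0 i == (p.2 : 'rV[R]_k) ord0 i]
        then m p.1 else 0))%:E.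
have G0 p : (0 <= G p)%E by rewrite lee_fin !mulr_ge0.
have eqE (a b : 'rV[R]_k) : [forall i, a ord0 i == b ord0 i] = (a == b).
  by apply/forallP/eqP => [h|-> //]; apply/rowP => i; exact/eqP/h.
pose h (x : X) := (\esum_(a in pts (f x)) \esum_(b in pts (f x)) G (x, a, b))%E.
have hE x : h x = (\esum_(u in pairs (diag_marking (f x) (fun y => m (x, y))) B1 B2 D) 1)%E.
  rewrite /h esum_esum// esum_mkcond [RHS]esum_mkcond; apply: eq_esum => -[a b] _.
  set z := diag_marking _ _; rewrite /G eqE.
  have [[aphi bphi]|nab] := pselect (pts (f x) a /\ pts (f x) b); last first.
    have n1 : ~ (pts (f x) `*`` (fun=> pts (f x))) (a, b) by move=> [? ?]; exact: nab.
    have n2 : ~ pairs z B1 B2 D (a, b) by move=> [[? _] [? _] _]; exact: nab.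
    by rewrite (memNset n1) (memNset n2).
  have y1 : (pts (f x) `*`` (fun=> pts (f x))) (a, b) by split.
  rewrite (mem_set y1) /=.
  have mkE : mark z a b = (if a == b then m (x, a) else 0).
    rewrite /z /= /diag_mark; case: asboolP => [[_ ->]|nab]; first by rewrite eqxx.
    by case: eqP => // ab; case: nab.
  rewrite !indicE -mkE.
  have [aB|aB] := boolP (a \in B1); last first.
    by rewrite !mul0r memNset// => -[[_ /mem_set]]; rewrite (negbTE aB).
  have [bB|bB] := boolP (b \in B2); last first.
    by rewrite mulr0 mul0r memNset// => -[_ [_ /mem_set]]; rewrite (negbTE bB).
  have [Dab|Dab] := boolP (mark z a b \in D); last first.
    by rewrite mulr0 memNset// => -[_ _ /mem_set]; rewrite (negbTE Dab).
  by rewrite !mulr1 mem_set//; split=> /=; [split=> //; exact: set_mem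
     |split=> //; exact: set_mem|exact: set_mem].
have fin_pairs x : finite_set (pairs (diag_marking (f x) (fun y => m (x, y))) B1 B2 D).
  apply: (@sub_finite_set _ _ ((pts (f x) `&` B1) `*` (pts (f x) `&` B2))).
    by move=> [a b] /= [? ? _].
  by apply: finite_setX; exact: pts_locally_finite.
rewrite (_ : setT `&` _ = setT `&` h @^-1` [set n%:R%:E]); last first.
  rewrite !setTI; apply/seteqP; split=> x /=; rewrite hE.
    by move=> /(esum_card R) ->.
  exact/esum_card_eq/fin_pairs.
have mh : measurable_fun setT h; last by apply: mh => //; exact: emeasurable_set1.
apply: (@measurable_config_esum R k _ _ f mf
   (fun p : X * V => (\esum_(b in pts (f p.1)) G (p, b))%E)); last first.
  by move=> p; apply: esum_ge0.
apply: (@measurable_config_esum R k _ _ (fun p : X * V => f p.1) _ G) => //.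
  exact: measurableT_comp mf measurable_fst.
apply/measurable_EFinP; apply: measurable_funM; first apply: measurable_funM.
- apply: (measurableT_comp (measurable_indic mB1)).
  exact: measurableT_comp measurable_snd measurable_fst.
- exact: measurableT_comp (measurable_indic mB2) measurable_snd.
apply: (measurableT_comp (measurable_indic mD)); apply: measurable_fun_ifT => //.
  apply: measurable_forallb => i; apply: measurable_fun_eqr.
    apply: (measurableT_comp (measurable_coord i)).
    exact: measurableT_comp measurable_snd measurable_fst.
  exact: measurableT_comp (measurable_coord i) measurable_snd.
exact: measurableT_comp mm measurable_fst.
Qed.

End marked_configurations.

(** * Markings driven by a random shift *)

Section random_marking.
Context (R : realType) (k : nat) (M : nat).
Notation V := (borel_rV R k).
Notation U := (shifts R k).
Notation C := (configT R k).
Notation mu := (unif_shift R M k).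
Context (m : C * U * V -> R) (mm : measurable_fun setT m).

Definition marking (phi : C) (u : U) : markedT R k :=
  diag_marking phi (fun y => m (phi, u, y)).

Lemma measurable_marking2 : measurable_fun setT (fun p : C * U => marking p.1 p.2).
Proof.
rewrite (_ : (fun p => _) = fun p : C * U =>
    diag_marking p.1 (fun y => m (p, y)) : markedT R k); last first.
  by apply/funext => -[phi u].
exact: measurable_diag_marking measurable_fst mm.
Qed.

Lemma measurable_marking phi : measurable_fun setT (marking phi).
Proof. exact: measurableT_comp measurable_marking2 (pair1_measurable phi). Qed.

Definition marking_mfun (phi : C) : {mfun U >-> markedT R k} :=
  HB.pack (marking phi) (isMeasurableFun.Build _ _ _ _ _ (measurable_marking phi)).

Definition marking_law (phi : C) : {measure set (markedT R k) -> \bar R} :=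
  distribution mu (marking_mfun phi).

Lemma marking_lawE phi A : marking_law phi A = mu (marking phi @^-1` A).
Proof. by []. Qed.

Let measurable_marking_law (A : set (markedT R k)) : measurable A ->
  measurable_fun [set: C] (marking_law ^~ A).
Proof.
move=> mA; rewrite (_ : (fun phi => _) = fun phi : C =>
    (\int[mu]_u (\1_A (marking phi u))%:E)%E); last first.
  apply/funext => phi; rewrite marking_lawE.
  rewrite -[RHS]/(\int[mu]_u (\1_(marking phi @^-1` A) u)%:E)%E.
  rewrite integral_indic ?setIT// -[X in measurable X]setTI.
  exact: measurable_marking.
apply: (measurable_fun_fubini_tonelli_F (fun p : C * U => (\1_A (marking p.1 p.2))%:E)).
  apply/measurable_EFinP.
  exact: measurableT_comp (measurable_indic mA) measurable_marking2.
by move=> p; rewrite lee_fin.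
Qed.

HB.instance Definition _ := isKernel.Build _ _ C (markedT R k) R marking_law
  measurable_marking_law.

Let marking_law_setT phi : marking_law phi setT = 1%E.
Proof. exact: probability_setT. Qed.

HB.instance Definition _ := Kernel_isProbability.Build _ _ C (markedT R k) R
  marking_law marking_law_setT.

Definition marking_kernel : R.-pker C ~> markedT R k := marking_law.

(** [Q] need not be measurable; a measurable [G] inside it carries the full mass. *)
Lemma marking_kernel_ae phi (Q : marked_config R k -> Prop) (G : set (markedT R k)) :
  measurable G -> (forall u, G (marking phi u)) -> (forall z, G z -> Q z) ->
  {ae marking_kernel phi, forall z, Q z}.
Proof.
move=> mG FG GQ; exists (~` G); split; first exact: measurableC.
  rewrite /marking_kernel/= marking_lawE (_ : _ @^-1` _ = set0) ?measure0//.
  by apply/seteqP; split=> // u /= /(_ (FG u)).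
by move=> z /= nQ /GQ.
Qed.

Lemma integral_marking_kernel phi (f : markedT R k -> \bar R) :
  measurable_fun setT f ->
  (\int[marking_kernel phi]_z f z = \int[mu]_u f (marking phi u))%E.
Proof.
move=> mf; rewrite integralE [RHS]integralE.
have transfer (h : markedT R k -> \bar R) : measurable_fun setT h ->
    (forall z, (0 <= h z)%E) ->
    (\int[marking_kernel phi]_z h z = \int[mu]_u h (marking phi u))%E.
  move=> mh h0; rewrite -[LHS]/(\int[pushforward mu (marking_mfun phi)]_z h z)%E.
  rewrite ge0_integral_pushforward//; exact: measurable_marking.
rewrite (transfer (f^\+)%E)//; last exact: measurable_funepos.
rewrite (transfer (f^\-)%E)//; last exact: measurable_funeneg.
rewrite -[fun u : U => f (marking phi u)]/(f \o marking phi).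
by have -> := funepos_comp f (marking phi); have -> := funeneg_comp f (marking phi).
Qed.

Context (Xi : set R) (mXi : measurable Xi) (Xi0 : Xi 0)
  (mXi_ : forall phi u y, pts phi y -> Xi (m (phi, u, y)))
  (m_shift : forall t phi u y, pts phi y ->
     m (config_shift t phi, shift_add u (vcoord t), y + t) = m (phi, u, y))
  (m_per : forall phi u y (z : nat -> int), pts phi y ->
     m (phi, shift_add u (fun i => (z i)%:~R * 2 ^+ M), y) = m (phi, u, y)).

Lemma marking_shift t phi u :
  marking (config_shift t phi) (shift_add u (vcoord t)) = marked_shift t (marking phi u).
Proof. by apply: diag_marking_shift => x xphi; exact: m_shift. Qed.

Lemma marking_periodic phi u (z : nat -> int) :
  marking phi (shift_add u (fun i => (z i)%:~R * 2 ^+ M)) = marking phi u.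
Proof.
apply: marked_config_eq => //=; apply/funext => x; apply/funext => y.
by rewrite /diag_mark; case: asboolP => // -[xphi _]; rewrite m_per.
Qed.

(** Translating the configuration corresponds to translating [u]. The law of [u] is not invariant
    under this, but by [m_per] the events at stake are periodic in [u], and on those it is. *)
Lemma marking_kernel_process d (Omega : measurableType d) (P : probability Omega R)
  (Phi : Omega -> C) : equivariant_process P Phi Xi marking_kernel.
Proof.
exists setT; split=> //.
- by apply: filterE.
- move=> phi _.
  have mG : measurable [set z : markedT R k | ground z = phi /\
      forall x y, pts phi x -> pts phi y -> Xi (mark z x y)].
    rewrite (_ : [set z | _] = [set z : markedT R k | ground z = phi] `&`
      \bigcap_(x in pts phi) \bigcap_(y in pts phi) [set z | Xi (mark z x y)]).
      apply: measurableI; first exact: measurable_ground.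
      apply: countable_bigcap_measurable => [|x _]; first exact: pts_countable.
      apply: countable_bigcap_measurable => [|y _]; first exact: pts_countable.
      by rewrite -[X in measurable X]setTI; exact: measurable_mark.
    apply/seteqP; split=> z /= [-> h]; split=> // x; first by move=> ? y ?; exact: h.
    by move=> y xphi yphi; exact: (h x xphi y yphi).
  apply: marking_kernel_ae mG _ _ => // u; split=> //= x y xphi yphi.
  by rewrite /diag_mark; case: asboolP => // _; exact: mXi_.
move=> t phi A _ mA; rewrite /marking_kernel/= !marking_lawE.
set E := marking (config_shift t phi) @^-1` A.
have mE : measurable E.
  by rewrite -[X in measurable X]setTI; exact: measurable_marking.
have mE' : measurable ((fun u => shift_add u (vcoord t)) @^-1` E).
  by rewrite -[X in measurable X]setTI; exact: measurable_shift_add.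
rewrite (_ : marking phi @^-1` _ = (fun u => shift_add u (vcoord t)) @^-1` E); last first.
  by apply/seteqP; split=> u /=; rewrite /E /= marking_shift.
have e1 : (\int[mu]_u (\1_E u)%:E = mu E)%E by rewrite integral_indic// setIT.
have e2 : (\int[mu]_u (\1_E (shift_add u (vcoord t)))%:E
    = mu ((fun u => shift_add u (vcoord t)) @^-1` E))%E.
  rewrite -[LHS]/(\int[mu]_u
    (\1_((fun u => shift_add u (vcoord t)) @^-1` E) u)%:E)%E.
  by rewrite integral_indic// setIT.
rewrite -[LHS]e1 -[RHS]e2; apply/esym.
apply: (@unif_shift_periodic R M M k (fun u => (\1_E u)%:E)) => //.
- exact/measurable_EFinP/measurable_indic.
- by move=> u z; rewrite !indicE; congr ((_ : bool)%:R%:E);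
    apply/idP/idP; rewrite !inE /E /= marking_periodic.
Qed.

End random_marking.

(** * Coverings by saturated cells and mass transport *)

(** One enumeration of [D] serves all [x], so the sum is a series of nonnegative functions, to be
    integrated termwise. *)
Lemma integral_esum d (T : measurableType d) (R : realType)
    (mu : {measure set T -> \bar R}) (I : pointedType) (D : set I)
    (f : I -> T -> \bar R) : countable D ->
  (forall i, measurable_fun setT (f i)) -> (forall i x, (0 <= f i x)%E) ->
  (\int[mu]_x (\esum_(i in D) f i x) = \esum_(i in D) \int[mu]_x f i x)%E.
Proof.
move=> cD mf f0; have [e [p [_ eE]]] := esum_series R cD.
rewrite eE; last by move=> i _; exact: integral_ge0.
under eq_integral do rewrite eE// eseries_mkcond.
rewrite [RHS]eseries_mkcond integral_nneseries//.
- by apply: eq_eseriesr => j _; case: (p j); rewrite ?integral0.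
- by move=> j; case: (p j).
- by move=> j x _; case: (p j).
Qed.

Section shifted_cells.
Context (R : realType) (k : nat) (alpha : R).
Notation V := (borel_rV R k).
Notation U := (shifts R k).
Notation C := (configT R k).
Notation S u := (same_cell (shift_coord u)).
Implicit Types (phi : config R k) (x t v : 'rV[R]_k) (u : U) (z : nat -> int).

Lemma fw_shifted M t phi u x :
  fw alpha (S (shift_add u (vcoord t))) M (config_shift t phi) (x + t)
  = fw alpha (S u) M phi x.
Proof.
apply: (@fw_transport _ _ _ (S u) _ phi _ t M) => //; first exact: config_shiftP.
by move=> n y y' _; exact: grid_shift.
Qed.

Lemma top_cell_shifted M t phi u x y :
  top_cell alpha (S (shift_add u (vcoord t))) M (config_shift t phi) (x + t) (y + t)
  = top_cell alpha (S u) M phi x y.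
Proof.
apply: (@top_cell_transport _ _ _ (S u) _ phi _ t M) => //; first exact: config_shiftP.
by move=> n z z' _; exact: grid_shift.
Qed.

Lemma top_side_shifted M t phi u y :
  top_side alpha (S (shift_add u (vcoord t))) M (config_shift t phi) (y + t)
  = top_side alpha (S u) M phi y.
Proof.
apply: (@top_side_transport _ _ _ (S u) _ phi _ t M) => //; first exact: config_shiftP.
by move=> n z z' _; exact: grid_shift.
Qed.

Lemma leader_shifted M t phi u y :
  leader alpha (S (shift_add u (vcoord t))) M (config_shift t phi) (y + t)
  = leader alpha (S u) M phi y.
Proof.
apply: (@leader_transport _ _ _ (S u) _ phi _ t M) => //; first exact: config_shiftP.
by move=> n z z' _; exact: grid_shift.
Qed.

Lemma top_cell_periodic M z phi u x y :
  top_cell alpha (S (shift_add u (fun i => (z i)%:~R * 2 ^+ M))) M phi x y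
  = top_cell alpha (S u) M phi x y.
Proof.
rewrite -[x in LHS]addr0 -[y in LHS]addr0.
apply: (@top_cell_transport _ _ _ (S u) _ phi _ 0 M) => //; first exact: pts_add0.
by move=> n a a' nM; exact: grid_periodic.
Qed.

Lemma top_side_periodic M z phi u y :
  top_side alpha (S (shift_add u (fun i => (z i)%:~R * 2 ^+ M))) M phi y
  = top_side alpha (S u) M phi y.
Proof.
rewrite -[y in LHS]addr0.
apply: (@top_side_transport _ _ _ (S u) _ phi _ 0 M) => //; first exact: pts_add0.
by move=> n a a' nM; exact: grid_periodic.
Qed.

Lemma leader_periodic M z phi u y :
  leader alpha (S (shift_add u (fun i => (z i)%:~R * 2 ^+ M))) M phi y
  = leader alpha (S u) M phi y.
Proof.
rewrite -[y in LHS]addr0.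
apply: (@leader_transport _ _ _ (S u) _ phi _ 0 M) => //; first exact: pts_add0.
by move=> n a a' nM; exact: grid_periodic.
Qed.

Definition cover_radius M (p : C * U * V) : R :=
  if leader alpha (S p.1.2) M p.1.1 p.2 then top_side alpha (S p.1.2) M p.1.1 p.2 else 0.

Lemma measurable_cover_radius M : measurable_fun setT (cover_radius M).
Proof.
by apply: measurable_fun_ifT => //; [exact: measurable_leader|exact: measurable_top_side].
Qed.

(** Leaders have radius at least 1, so radius 0 singles out the other points; the convention 0^0 = 0
    makes these free even when alpha = 0. *)
Lemma cover_radius_pow M phi u y : rpow (cover_radius M (phi, u, y)) alpha =
  (leader alpha (S u) M phi y)%:R * top_side alpha (S u) M phi y `^ alpha.
Proof.
rewrite /rpow /cover_radius/=; case: (leader _ _ _ _ _); last by rewrite eqxx mul0r.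
by rewrite mul1r gt_eqF// (lt_le_trans ltr01)// top_side_ge1.
Qed.

Definition covering M : R.-pker C ~> markedT R k :=
  marking_kernel M (measurable_cover_radius M).

Lemma covering_is_covering M d (Omega : measurableType d) (P : probability Omega R)
  (Phi : Omega -> C) : equivariant_covering P Phi (covering M).
Proof.
split.
  apply: marking_kernel_process.
  - rewrite (_ : [set s | _] = [set 0] `|` `[1, +oo[%classic).
      by apply: measurableU.
    by apply/seteqP; split=> s /=; rewrite in_itv/= andbT.
  - by left.
  - move=> phi u y _; rewrite /cover_radius/=; case: ifP => _; last by left.
    by right; exact: top_side_ge1.
  - by move=> t phi u y _; rewrite /cover_radius/= leader_shifted top_side_shifted.
  - by move=> phi u y z _; rewrite /cover_radius/= leader_periodic top_side_periodic.
apply: filterE => o; set phi := Phi o.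
(* A measurable form of the covering event, with quantifiers over the countable set of points. *)
pose G := [set z : markedT R k | ground z = phi] `&`
  \bigcap_(x in pts phi) \bigcup_(v in pts phi)
     [set z | (pmark z v != 0) && (`|x - v| <= pmark z v)].
apply: (@marking_kernel_ae R k M _ _ phi _ G).
- apply: measurableI; first exact: measurable_ground.
  apply: countable_bigcap_measurable => [|x _]; first exact: pts_countable.
  apply: countable_bigcup_measurable => [|v _]; first exact: pts_countable.
  apply: measurable_pred; apply: measurable_and.
    by apply: measurable_neg; apply: measurable_fun_eqr => //; exact: measurable_mark.
  by apply: measurable_fun_ler => //; exact: measurable_mark.
- move=> u; split=> // x xphi.
  have [|||||y [yphi xy ly]] := @leader_exists R k alpha (S u) phi _ _ _ _ _ M x xphi.
  - exact: same_cell_refl.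
  - exact: same_cell_sym.
  - exact: same_cell_trans.
  - exact: same_cell_nest.
  - exact: same_cell_dist.
  have E : pmark (marking (cover_radius M) phi u) y = top_side alpha (S u) M phi y.
    by rewrite /marking pmark_diag// /cover_radius/= ly.
  have h : (pmark (marking (cover_radius M) phi u) y != 0) &&
      (`|x - y| <= pmark (marking (cover_radius M) phi u) y).
    rewrite E gt_eqF ?(lt_le_trans ltr01 (top_side_ge1 _ _ _ _ _))//=.
    by apply: top_cell_dist xy; exact: same_cell_dist.
  by exists y.
move=> z [zphi zG] x xphi; have [v vphi /andP[v0 xv]] := zG x xphi.
by exists v.
Qed.

End shifted_cells.

Section mass_transport.
Context (R : realType) (k : nat) (alpha : R).
Notation V := (borel_rV R k).
Notation U := (shifts R k).
Notation C := (configT R k).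
Notation S u := (same_cell (shift_coord u)).
Context (M : nat).
Notation mu := (unif_shift R M k).
Implicit Types (phi : config R k) (x y t : 'rV[R]_k) (u : U).

Definition sent phi u x y : R := fw alpha (S u) M phi x *
  (top_cell alpha (S u) M phi x y && leader alpha (S u) M phi y)%:R.

Lemma sent_ge0 phi u x y : 0 <= sent phi u x y.
Proof. by rewrite mulr_ge0 ?fw_ge0. Qed.

Lemma sent_le1 phi u x y : sent phi u x y <= 1.
Proof.
rewrite /sent; case: (_ && _); rewrite ?mulr1 ?mulr0//.
exact: fw_le1_all.
Qed.

Lemma measurable_sent : measurable_fun setT
  (fun p : C * V * V * U => sent p.1.1.1 p.2 p.1.1.2 p.1.2).
Proof.
have m11 : measurable_fun setT (fun p : C * V * V * U => (p.1.1.1, p.2)).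
  apply: measurable_fun_pair; last exact: measurable_snd.
  apply: measurableT_comp measurable_fst _.
  exact: measurableT_comp measurable_fst measurable_fst.
have mx : measurable_fun setT (fun p : C * V * V * U => p.1.1.2).
  apply: measurableT_comp measurable_snd _.
  exact: measurableT_comp measurable_fst measurable_fst.
have my : measurable_fun setT (fun p : C * V * V * U => p.1.2).
  exact: measurableT_comp measurable_snd measurable_fst.
have mux : measurable_fun setT (fun p : C * V * V * U => (p.1.1.1, p.2, p.1.1.2)).
  exact: measurable_fun_pair.
have muy : measurable_fun setT (fun p : C * V * V * U => (p.1.1.1, p.2, p.1.2)).
  exact: measurable_fun_pair.
have muxy : measurable_fun setT
    (fun p : C * V * V * U => (p.1.1.1, p.2, p.1.1.2, p.1.2)).
  exact: measurable_fun_pair.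
apply: measurable_funM; first exact: measurableT_comp (measurable_fw alpha M) mux.
apply: measurable_natr; apply: measurable_and.
  exact: measurableT_comp (measurable_top_cell alpha M) muxy.
exact: measurableT_comp (measurable_leader alpha M) muy.
Qed.

Lemma measurable_sent_shift phi x y : measurable_fun setT (fun u => sent phi u x y).
Proof.
have mp : measurable_fun setT (fun u : U => ((phi : C), (x : V), (y : V), u)).
  exact: measurable_fun_pair.
exact: measurableT_comp measurable_sent mp.
Qed.

(** Point-stationarity speaks of functions of the configuration and two points, so the shift is
    integrated out before mass is transported. *)
Definition flux phi x y : R := fine (\int[mu]_u (sent phi u x y)%:E)%E.

Lemma fluxE phi x y : (flux phi x y)%:E = (\int[mu]_u (sent phi u x y)%:E)%E.
Proof.
rewrite /flux fineK// ge0_fin_numE; last first.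
  by apply: integral_ge0 => u _; rewrite lee_fin sent_ge0.
apply: (@le_lt_trans _ _ 1%E); last exact: ltry.
apply: integral_le1; first exact: measurable_sent_shift.
  by move=> u; exact: sent_ge0.
by move=> u; exact: sent_le1.
Qed.

Lemma flux_ge0 phi x y : 0 <= flux phi x y.
Proof. by rewrite -lee_fin fluxE integral_ge0// => u _; rewrite lee_fin sent_ge0. Qed.

Lemma measurable_flux :
  measurable_fun setT (fun p : C * V * V => flux p.1.1 p.1.2 p.2).
Proof.
apply/measurable_EFinP.
rewrite (_ : _ \o _ = fun p : C * V * V =>
    (\int[mu]_u (sent p.1.1 u p.1.2 p.2)%:E)%E); last first.
  by apply/funext => p; rewrite /= fluxE.
apply: (measurable_fun_fubini_tonelli_F (fun p : C * V * V * U =>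
  (sent p.1.1.1 p.2 p.1.1.2 p.1.2)%:E)).
  by apply/measurable_EFinP; exact: measurable_sent.
by move=> p; rewrite lee_fin sent_ge0.
Qed.

Lemma flux_shift t phi x y : flux (config_shift t phi) (x + t) (y + t) = flux phi x y.
Proof.
rewrite /flux; congr fine.
rewrite -[LHS](@unif_shift_periodic R M M k _ (vcoord t))//; last 3 first.
- by apply/measurable_EFinP; exact: measurable_sent_shift.
- by move=> u; rewrite lee_fin sent_ge0.
- move=> u z; rewrite /sent top_cell_periodic leader_periodic EFinM.
  have /= -> := @fw_periodic R k alpha M (config_shift t phi) (x + t) u z.
  by rewrite -EFinM.
apply: eq_integral => u _.
by rewrite /sent fw_shifted top_cell_shifted leader_shifted.
Qed.

(** For each [u] the top cell of [x] has exactly one leader, and it receives the whole weight of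
    [x]. *)
Lemma flux_out phi x : pts phi x ->
  (\esum_(y in pts phi) (flux phi x y)%:E = (mean_weight alpha M phi x)%:E)%E.
Proof.
move=> xphi; under eq_esum do rewrite fluxE.
rewrite -integral_esum//; last 3 first.
- exact: pts_countable.
- by move=> y; apply/measurable_EFinP; exact: measurable_sent_shift.
- by move=> y u; rewrite lee_fin sent_ge0.
rewrite mean_weightE; apply: eq_integral => u _.
have [|||||y [yphi xy ly]] := @leader_exists R k alpha (S u) phi _ _ _ _ _ M x xphi.
- exact: same_cell_refl.
- exact: same_cell_sym.
- exact: same_cell_trans.
- exact: same_cell_nest.
- exact: same_cell_dist.
rewrite (esumID [set y]); last by move=> z _; rewrite lee_fin sent_ge0.
rewrite (_ : pts phi `&` [set y] = [set y]); last first.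
  by apply/seteqP; split=> [z []//|z ->].
rewrite esum_set1 ?lee_fin ?sent_ge0// esum1 ?adde0.
  by rewrite /sent xy ly mulr1.
move=> z [zphi zy]; rewrite /sent.
have [xz|] := boolP (top_cell _ _ _ _ _ _); last by rewrite mulr0.
have [lz|] := boolP (leader _ _ _ _ _); last by rewrite mulr0.
case: zy; apply: (@leader_unique R k alpha (S u) phi _ _ _ M x) => //.
- exact: same_cell_sym.
- exact: same_cell_trans.
- exact: same_cell_nest.
Qed.

(** A leader collects the mass of its top cell, known from [mass_top_cell]; any other point receives
    nothing and has radius 0. *)
Lemma flux_in phi y : pts phi y ->
  (\esum_(x in pts phi) (flux phi x y)%:E
   = \int[mu]_u (rpow (cover_radius alpha M (phi, u, y)) alpha)%:E)%E.
Proof.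
move=> yphi; under eq_esum do rewrite fluxE.
rewrite -integral_esum//; last 3 first.
- exact: pts_countable.
- by move=> x; apply/measurable_EFinP; exact: measurable_sent_shift.
- by move=> x u; rewrite lee_fin sent_ge0.
apply: eq_integral => u _; rewrite cover_radius_pow.
have [ly|nly] := boolP (leader alpha (S u) M phi y); last first.
  by rewrite mul0r esum1// => x _; rewrite /sent (negbTE nly) andbF mulr0.
rewrite mul1r -(@mass_top_cell R k alpha (S u) phi)//.
- rewrite fsbig_pred_esum.
  + by apply: eq_esum => x _; rewrite /sent ly andbT mulrC.
  + apply: finite_top_cell; first exact: same_cell_sym.
      exact: same_cell_nest.
    exact: same_cell_dist.
  + by move=> x; exact: fw_ge0.
- exact: same_cell_refl.
- exact: same_cell_sym.
- exact: same_cell_trans.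
- exact: same_cell_nest.
- exact: same_cell_dist.
Qed.

End mass_transport.

(** * Frostman's weight *)

Section frostman.
Context (R : realType) (k : nat) (alpha : R) (d : measure_display)
  (Omega : measurableType d) (P : probability Omega R) (Phi : Omega -> configT R k).
Hypotheses (mPhi : measurable_fun setT Phi) (stPhi : point_stationary P Phi)
  (alpha_ge0 : 0 <= alpha).
Notation V := (borel_rV R k).
Notation U := (shifts R k).
Notation C := (configT R k).

Let measurable_at0 (f : C * V -> R) : measurable_fun setT f ->
  measurable_fun setT (fun o => f (Phi o, 0)).
Proof.
move=> mf; have mp : measurable_fun setT (fun o => (Phi o, (0 : V))).
  by apply: measurable_fun_pair; [exact: mPhi|exact: measurable_cst].
exact: measurableT_comp mf mp.
Qed.

Let measurable_rpow_mark : measurable_fun setT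
  (fun z : markedT R k => (rpow (pmark z 0) alpha)%:E).
Proof.
apply/measurable_EFinP; apply: measurable_fun_ifT => //.
  by apply: measurable_fun_eqr => //; exact: measurable_mark.
apply: (measurableT_comp (measurable_powR alpha)); exact: measurable_mark.
Qed.

Let rpow_ge0 (r : R) : 0 <= rpow r alpha.
Proof. by rewrite /rpow; case: ifP => // _; exact: powR_ge0. Qed.

Lemma covering_inner M (phi : config R k) : pts phi 0 ->
  (\int[covering k alpha M phi]_z (rpow (pmark z 0) alpha)%:E
   = \int[unif_shift R M k]_u (rpow (cover_radius alpha M (phi, u, 0)) alpha)%:E)%E.
Proof.
move=> phi0; rewrite /covering (@integral_marking_kernel R k M _ _ phi _ measurable_rpow_mark).
apply: eq_integral => u _; congr (rpow _ _)%:E.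
exact: pmark_diag.
Qed.

Lemma covering_expectation M :
  expectation_marked P Phi (covering k alpha M) (fun z => rpow (pmark z 0) alpha)
  = (\int[P]_o (mean_weight alpha M (Phi o) 0)%:E)%E.
Proof.
have [ae0 /(_ (flux alpha M)) mtp] := stPhi.
transitivity (\int[P]_o \esum_(x in pts (Phi o)) (flux alpha M (Phi o) x 0)%:E)%E.
  (* The flux formulas hold at points of the configuration, hence at 0 only on the almost sure event
     that 0 is a point. *)
  apply: (@ae_eq_integral _ _ _ P setT _ _ measurableT).
  - have mI : measurable_fun setT (fun phi : C =>
        \int[covering k alpha M phi]_z (rpow (pmark z 0) alpha)%:E)%E.
      have rp0 (z : markedT R k) : (0 <= (rpow (pmark z 0) alpha)%:E)%E.
        by rewrite lee_fin.
      have mK := measurable_kernel (covering k alpha M).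
      exact: (measurable_fun_integral_kernel mK rp0 measurable_rpow_mark).
    exact: measurableT_comp mI mPhi.
  - apply: (@measurable_config_esum R k _ _ Phi mPhi
      (fun p : Omega * V => (flux alpha M (Phi p.1) p.2 0)%:E)).
      apply/measurable_EFinP.
      have mp : measurable_fun setT (fun p : Omega * V => (Phi p.1, p.2, (0 : V))).
        apply: measurable_fun_pair; last exact: measurable_cst.
        apply: measurable_fun_pair; last exact: measurable_snd.
        exact: measurableT_comp mPhi measurable_fst.
      exact: measurableT_comp (measurable_flux alpha M) mp.
    by move=> p; rewrite lee_fin flux_ge0.
  - apply: filterS ae0 => o phi0 _.
    exact: etrans (covering_inner M phi0) (esym (flux_in alpha M phi0)).
rewrite -mtp; last 3 first.
- exact: measurable_flux.
- by move=> *; exact: flux_ge0.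
- by move=> *; exact: flux_shift.
apply: (@ae_eq_integral _ _ _ P setT _ _ measurableT).
- apply: (@measurable_config_esum R k _ _ Phi mPhi
    (fun p : Omega * V => (flux alpha M (Phi p.1) 0 p.2)%:E)).
    apply/measurable_EFinP.
    have mp : measurable_fun setT (fun p : Omega * V => (Phi p.1, (0 : V), p.2)).
      apply: measurable_fun_pair; last exact: measurable_snd.
      apply: measurable_fun_pair; last exact: measurable_cst.
      exact: measurableT_comp mPhi measurable_fst.
    exact: measurableT_comp (measurable_flux alpha M) mp.
  by move=> p; rewrite lee_fin flux_ge0.
- apply/measurable_EFinP; exact: measurable_at0 (measurable_mean_weight alpha M).
- by apply: filterS ae0 => o phi0 _; exact: flux_out.
Qed.

Lemma hausdorff1_le_limit_weight :
  (hausdorff1 P Phi alpha <= \int[P]_o (limit_weight alpha (Phi o) 0)%:E)%E.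
Proof.
have cv : (\int[P]_o (mean_weight alpha M (Phi o) 0)%:E)%E @[M --> \oo]
    --> (\int[P]_o (limit_weight alpha (Phi o) 0)%:E)%E.
  apply: (@dominated_cvg _ _ _ P setT _ _ _ (cst 1%E)) => //.
  - by move=> M; apply/measurable_EFinP; exact: measurable_at0 (measurable_mean_weight alpha M).
  - move=> o _; apply: cvg_EFin; first by apply: nearW.
    exact: mean_weight_cvg.
  - exact: finite_measure_integrable_cst.
  - move=> M o _; rewrite /= lee_fin ger0_norm ?mean_weight_ge0//.
    exact: mean_weight_le1.
rewrite -(cvg_lim _ cv)//; apply: lime_ge; first by apply/cvg_ex; eexists; exact: cv.
apply: nearW => M; rewrite -covering_expectation.
by apply: ereal_inf_lbound; exists (covering k alpha M) => //; exact: covering_is_covering.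
Qed.

Definition frostman_mark (p : C * U * V) : R := 3 ^- k * limit_weight alpha p.1.1 p.2.

Lemma measurable_frostman_mark : measurable_fun setT frostman_mark.
Proof.
have mp : measurable_fun setT (fun p : C * U * V => (p.1.1, p.2)).
  apply: measurable_fun_pair; last exact: measurable_snd.
  exact: measurableT_comp measurable_fst measurable_fst.
apply: measurable_funM => //.
exact: measurableT_comp (measurable_limit_weight alpha) mp.
Qed.

(** The marks are constant in [u], so this weight carries no extra randomness and the box of side
    [2 ^+ 0] is an arbitrary choice. *)
Definition frostman_weight : R.-pker C ~> markedT R k :=
  marking_kernel 0 measurable_frostman_mark.

Lemma frostman_weight_equivariant : equivariant_weight P Phi frostman_weight.
Proof.
apply: marking_kernel_process.
- rewrite (_ : [set s | _] = `[0, +oo[%classic)//.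
  by apply/seteqP; split=> s /=; rewrite in_itv/= andbT.
- by rewrite /=.
- by move=> phi u y _; rewrite /frostman_mark/= mulr_ge0 ?limit_weight_ge0 ?invr_ge0 ?exprn_ge0.
- by move=> t phi u y _; rewrite /frostman_mark/= limit_weight_shift.
- by move=> phi u y z _.
Qed.

Lemma frostman_weight_ae (phi : config R k) : {ae frostman_weight phi, forall z,
  ground z = phi /\ forall x, pts phi x -> pmark z x = 3 ^- k * limit_weight alpha phi x}.
Proof.
apply: (@marking_kernel_ae R k 0 _ _ phi _ ([set z : markedT R k | ground z = phi] `&`
  \bigcap_(x in pts phi) [set z | pmark z x == 3 ^- k * limit_weight alpha phi x])).
- apply: measurableI; first exact: measurable_ground.
  apply: countable_bigcap_measurable => [|x _]; first exact: pts_countable.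
  apply: measurable_pred; apply: measurable_fun_eqr => //; exact: measurable_mark.
- by move=> u; split=> // x xphi; apply/eqP; rewrite pmark_diag.
- by move=> z [zphi h]; split=> // x xphi; apply/eqP; exact: h.
Qed.

Lemma frostman_weight_ball (phi : config R k) (z : marked_config R k) : ground z = phi ->
  (forall x, pts phi x -> pmark z x = 3 ^- k * limit_weight alpha phi x) ->
  forall v r, 1 <= r -> (weight_of z (nball phi r v) <= (r `^ alpha)%:E)%E.
Proof.
move=> zphi zw v r r1; rewrite /weight_of zphi.
have r0 : r != 0 by rewrite gt_eqF// (lt_le_trans ltr01).
rewrite (_ : _ `&` _ = pts phi `&` [set x | `|x - v| <= r]); last first.
  by apply/seteqP; split=> [x [xphi [_ _ xv]]|x [xphi /= xv]]; split.
have fN := finite_ball phi v r.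
rewrite (eq_esum (b := fun x => (3 ^- k * limit_weight alpha phi x)%:E)); last first.
  by move=> x [xphi _]; rewrite zw.
rewrite esum_fset//; last first.
  by move=> x _; rewrite lee_fin mulr_ge0 ?limit_weight_ge0 ?invr_ge0 ?exprn_ge0.
rewrite fsumEFin// lee_fin -mulr_fsumr.
rewrite ler_pdivrMl ?exprn_gt0//.
exact: limit_weight_ball.
Qed.

Lemma frostman_weight_inner (phi : config R k) : pts phi 0 ->
  (\int[frostman_weight phi]_z (pmark z 0)%:E
   = (3 ^- k * limit_weight alpha phi 0)%:E)%E.
Proof.
move=> phi0; have mpm : measurable_fun setT (fun z : markedT R k => (pmark z 0)%:E).
  by apply/measurable_EFinP; exact: measurable_mark.
rewrite /frostman_weight (@integral_marking_kernel R k 0 _ _ phi _ mpm).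
rewrite -[RHS](integral_unif_shift_cst 0 k).
by apply: eq_integral => u _; congr (_%:E); exact: pmark_diag.
Qed.

Lemma frostman_weight_expectation :
  expectation_marked P Phi frostman_weight (fun z => pmark z 0)
  = ((3 ^- k)%:E * \int[P]_o (limit_weight alpha (Phi o) 0)%:E)%E.
Proof.
have [ae0 _] := stPhi.
have mlw := measurable_at0 (measurable_limit_weight alpha).
have mpm : measurable_fun setT (fun z : markedT R k => (pmark z 0)%:E).
  by apply/measurable_EFinP; exact: measurable_mark.
have lw0 o : setT o -> (0 <= (limit_weight alpha (Phi o) 0)%:E)%E.
  by move=> _; rewrite lee_fin limit_weight_ge0.
have k0 : (0 <= (3 ^- k : R)%:E)%E by rewrite lee_fin invr_ge0 exprn_ge0.
have mlwE : measurable_fun setT (fun o => (limit_weight alpha (Phi o) 0)%:E).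
  by apply/measurable_EFinP; exact: mlw.
rewrite -(@ge0_integralZl _ _ _ P setT measurableT _ mlwE _ lw0 k0).
apply: (@ae_eq_integral _ _ _ P setT _ _ measurableT).
(* As the marking is constant in [u], the inner integral is its value at the default shift [point].
   This gives measurability in [o] also where 0 is not a point. *)
- rewrite (_ : (fun o => _) = fun o =>
    (pmark (marking frostman_mark (Phi o) (point : U)) 0)%:E).
    apply/measurable_EFinP; apply: (measurableT_comp (measurable_mark 0 0)).
    have mp : measurable_fun setT (fun o => (Phi o, (point : U))).
      by apply: measurable_fun_pair; [exact: mPhi|exact: measurable_cst].
    exact: measurableT_comp (measurable_marking2 measurable_frostman_mark) mp.
  apply/funext => o.
  rewrite /frostman_weight (@integral_marking_kernel R k 0 _ _ (Phi o) _ mpm).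
  rewrite -[RHS](integral_unif_shift_cst 0 k).
  by apply: eq_integral => u _.
- exact: (measurable_funeM (3 ^- k)%:E mlwE).
- apply: filterS ae0 => o phi0 _; rewrite -EFinM; exact: frostman_weight_inner.
Qed.

End frostman.

Theorem theorem7p16 (R : realType) (k : nat) (d : measure_display)
    (Omega : measurableType d) (P : probability Omega R)
    (Phi : Omega -> configT R k) (alpha : R)
    (mPhi : measurable_fun [set: Omega] Phi)
    (stPhi : point_stationary P Phi)
    (alpha_ge0 : 0 <= alpha) :
  exists w : R.-pker configT R k ~> markedT R k,
    [/\ equivariant_weight P Phi w,
        almost_surely P Phi w (fun phi z => forall v, pts phi v ->
          forall r : R, 1 <= r ->
            (weight_of z (nball phi r v) <= (r `^ alpha)%:E)%E),
        (((3%:R ^- k)%:E * hausdorff1 P Phi alpha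
          <= expectation_marked P Phi w (fun z => pmark z 0))%E) &
        ((0%:E < hausdorff1 P Phi alpha)%E ->
         ~ almost_surely P Phi w (fun _ z => pmark z 0 = 0))].
Proof.
have pos : 0 < 3 ^- k :> R by rewrite invr_gt0 exprn_gt0.
have [ae0 _] := stPhi.
exists (frostman_weight k alpha); split.
- exact: frostman_weight_equivariant.
- apply: filterE => o; have F := ae_filter_ringOfSetsType (frostman_weight k alpha (Phi o)).
  apply: (@filterS _ _ F _ _ _ (frostman_weight_ae alpha (Phi o))) => z [zphi zw] v _ r.
  exact: frostman_weight_ball.
- rewrite frostman_weight_expectation//; apply: lee_wpmul2l.
    by rewrite lee_fin ltW.
  exact: hausdorff1_le_limit_weight.
(* If the mark at 0 vanished almost surely, so would its inner mean, which is [3 ^- k] times the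
   limit weight at 0; the integral bounding the content would then be 0. *)
move=> H0 aeW; have := hausdorff1_le_limit_weight alpha mPhi stPhi.
apply/negP; rewrite -ltNge; apply: le_lt_trans H0.
rewrite (@ae_eq_integral _ _ _ P setT (cst 0%E))//.
- by rewrite integral0.
- apply/measurable_EFinP.
  have mp : measurable_fun setT (fun o => (Phi o, (0 : borel_rV R k))).
    by apply: measurable_fun_pair; [exact: mPhi|exact: measurable_cst].
  exact: measurableT_comp (measurable_limit_weight alpha) mp.
apply: filterS2 ae0 aeW => o phi0 W0 _.
have : ((3 ^- k * limit_weight alpha (Phi o) 0)%:E = 0)%E.
  rewrite -frostman_weight_inner//.
  rewrite (@ae_eq_integral _ _ _ _ setT (cst 0%E))//.
  - by rewrite integral0.
  - by apply/measurable_EFinP; exact: measurable_mark.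
  - have F := ae_filter_ringOfSetsType (frostman_weight k alpha (Phi o)).
    by apply: (@filterS _ _ F _ _ _ W0) => z /= -> _.
by move=> /eqP; rewrite eqe mulf_eq0 gt_eqF//= => /eqP ->.
Qed.
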